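(* Let $\mathcal{S}$ be an $\eta$-sparse family (in a dyadic lattice of $\mathbb{R}^n$), and $b\in\mathrm{BMO}$. Let $Q$ be a cube. If $\mathrm{supp}\,f\subseteq Q$, then for every $t>0$ $$\left|\left\{x\in Q:\mathcal{A}^r_{\mathcal{S}}|f|(x)>tMf(x)\right\}\right|\le c_1e^{-c_2t^r}|Q|,\qquad r>0,$$ $$\left|\left\{x\in Q:\mathcal{T}_{\mathcal{S},b}f(x)+\mathcal{T}^*_{\mathcal{S},b}f(x)>tM^2f(x)\right\}\right|\le c_1e^{-\sqrt{c_2\frac{t}{\|b\|_{\mathrm{BMO}}}}}|Q|,$$ where $c_1,c_2$ only depend on $n$ and $\eta$.
   Context: Cubes have sides parallel to the axes; $M$ is the Hardy–Littlewood maximal operator, $M^2=M\circ M$; $\langle h\rangle_P=\frac1{|P|}\int_Ph$, $b_P=\langle b\rangle_P$, $\|b\|_{\mathrm{BMO}}=\sup_P\frac1{|P|}\int_P|b-b_P|$. $$\mathcal{A}^r_{\mathcal{S}}f(x)=\left(\sum_{P\in\mathcal{S}}\langle|f|\rangle_P^r\chi_P(x)\right)^{1/r},\quad \mathcal{T}_{\mathcal{S},b}f(x)=\sum_{P\in\mathcal{S}}|b(x)-b_P|\langle|f|\rangle_P\chi_P(x),\quad \mathcal{T}^*_{\mathcal{S},b}f(x)=\sum_{P\in\mathcal{S}}\langle|b-b_P||f|\rangle_P\chi_P(x).$$ For a cube $P$, $\mathcal{D}(P)$ is the dyadic grid obtained by repeatedly subdividing $P$ and its descendants into $2^n$ equal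 cubes. A dyadic lattice $\mathcal{D}$ is a family of cubes such that: (1) if $P\in\mathcal{D}$ then every descendant of $P$ is in $\mathcal{D}$; (2) for any $P_1,P_2\in\mathcal{D}$ there is $P\in\mathcal{D}$ with $P_1,P_2\in\mathcal{D}(P)$; (3) for every compact $K$ there is $P\in\mathcal{D}$ with $K\subseteq P$. $\mathcal{S}\subseteq\mathcal{D}$ is $\eta$-sparse, $\eta\in(0,1)$, if for each $P\in\mathcal{S}$ there is a measurable $E_P\subseteq P$ with $\eta|P|\le|E_P|$, the $E_P$ being pairwise disjoint.
   Formalization: With one c_1, c_2 for all r>0 the first bound fails as r→0 (f=χ_Q, S = ancestors of Q). Here c_2 depends only on n, η, and c_1 on n, η and a lower bound r_0 of r; in the second bound both depend only on n, η. Cubes are half-open and f, b Borel. *)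

(* Defs.v *)
From HB Require Import structures.
From mathcomp Require Import all_boot all_order all_algebra.
From mathcomp Require Import all_classical all_reals all_analysis.
Import Order.TTheory GRing.Theory Num.Theory.
Import numFieldNormedType.Exports.

Set Implicit Arguments.
Unset Strict Implicit.
Unset Printing Implicit Defensive.

Local Open Scope classical_set_scope.
Local Open Scope ring_scope.

(** [rspace R n] is R^n with its Borel (= product) sigma-algebra. *)
Notation rspace R n := (n.-tuple (measurableTypeR R)).

(** Lebesgue measure on R^n, as the n-fold product of the one-dimensional one:
    [tuple_product m1 m] is the image of [m1 \x m] under [(u, x) |-> u :: x]. *)

Section tuple_product.
Context d (T : measurableType d) (R : realType) (n : nat).
Variables (m1 : {sigma_finite_measure set T -> \bar R})
  (m : {sigma_finite_measure set (n.-tuple T) -> \bar R}).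

Definition tcons (p : T * n.-tuple T) : n.+1.-tuple T :=
  [the n.+1.-tuple T of p.1 :: p.2].

Lemma measurable_tcons : measurable_fun setT tcons.
Proof. exact: (measurable_cons measurable_fst measurable_snd). Qed.

Definition tuple_product : set (n.+1.-tuple T) -> \bar R :=
  pushforward (m1 \x m)%E tcons.

Let tuple_product0 : tuple_product set0 = 0%E.
Proof. by rewrite /tuple_product /pushforward preimage_set0 measure0. Qed.

Let tuple_product_ge0 A : (0 <= tuple_product A)%E.
Proof. by rewrite /tuple_product /pushforward; exact: measure_ge0. Qed.

Let preimage_tcons (A : set (n.+1.-tuple T)) :
  measurable A -> measurable (tcons @^-1` A).
Proof.
by move=> mA; rewrite -[X in measurable X]setTI; exact: measurable_tcons.
Qed.

Let tuple_product_sigma_additive : semi_sigma_additive tuple_product.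
Proof.
move=> F mF tF mUF; rewrite /tuple_product /pushforward preimage_bigcup.
apply: measure_semi_sigma_additive.
- by move=> k; exact: preimage_tcons.
- apply/trivIsetP => /= i j _ _ ij; rewrite -preimage_setI.
  by move/trivIsetP : tF => /(_ _ _ _ _ ij) ->//; rewrite preimage_set0.
- by rewrite -preimage_bigcup; exact: preimage_tcons.
Qed.

HB.instance Definition _ := isMeasure.Build _ _ _ tuple_product
  tuple_product0 tuple_product_ge0 tuple_product_sigma_additive.

Let tuple_product_sigma_finite : sigma_finite setT tuple_product.
Proof.
have /sigma_finiteP[F [TF ndF Foo]] := sigma_finiteT m1.
have /sigma_finiteP[G [TG ndG Goo]] := sigma_finiteT m.
pose g (x : n.+1.-tuple T) : T * n.-tuple T := (thead x, [tuple of behead x]).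
have mg : measurable_fun setT g.
  apply/measurable_fun_pair; first exact: measurable_tnth.
  exact: measurable_behead.
have gK p : g (tcons p) = p.
  by case: p => u x; rewrite /g theadE; congr pair; apply/val_inj.
exists (fun k => g @^-1` (F k `*` G k)).
  apply/seteqP; split=> // x _.
  have [i _ Fi] : (\bigcup_i F i) (g x).1 by rewrite -TF.
  have [j _ Gj] : (\bigcup_i G i) (g x).2 by rewrite -TG.
  exists (maxn i j) => //; split.
  - by move: (g x).1 Fi; exact/subsetPset/ndF/leq_maxl.
  - by move: (g x).2 Gj; exact/subsetPset/ndG/leq_maxr.
move=> k; have [mF Fk] := Foo k; have [mG Gk] := Goo k; split.
  by rewrite -[X in measurable X]setTI; apply: mg => //; exact: measurableX.
rewrite /tuple_product /pushforward -comp_preimage.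
rewrite (_ : g \o tcons = idfun) ?preimage_id//; last first.
  by apply/funext => p /=.
by rewrite product_measure1E// lte_mul_pinfty// ge0_fin_numE.
Qed.

HB.instance Definition _ := Measure_isSigmaFinite.Build _ _ _ tuple_product
  tuple_product_sigma_finite.

End tuple_product.

Fixpoint lebn (R : realType) (n : nat) :
    {sigma_finite_measure set (rspace R n) -> \bar R} :=
  match n with
  | 0 => [the {sigma_finite_measure set (rspace R 0) -> \bar R} of
            dirac ([tuple] : rspace R 0)]
  | n'.+1 => [the {sigma_finite_measure set (rspace R n'.+1) -> \bar R} of
            tuple_product lebesgue_measure (lebn R n')]
  end.

(** Cubes with sides parallel to the axes; they are half-open, so that the 2^n
    children of a cube partition it. *)
Definition cube (R : realType) n (a : rspace R n) (l : R) : set (rspace R n) :=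
  [set x | forall i, tnth a i <= tnth x i < tnth a i + l].

Lemma cube0 (R : realType) (a : rspace R 0) (l : R) : cube a l = setT.
Proof. by apply/seteqP; split=> // x _ []. Qed.

Lemma cubeS (R : realType) n (a : rspace R n.+1) (l : R) :
  @tcons _ (measurableTypeR R) n @^-1` cube a l =
  `[thead a, thead a + l[%classic `*` cube ([tuple of behead a] : rspace R n) l.
Proof.
have tl j : tnth a (lift ord0 j) = tnth [tuple of behead a] j.
  by rewrite [in LHS](tuple_eta a) tnthS.
have tc u x j : tnth (tcons (u, x)) (lift ord0 j) = tnth x j.
  by rewrite !(tnth_nth u).
apply/seteqP; split=> [[u x] ax|[u x] [hu hx] i].
  split=> [|j]; first by have := ax ord0; rewrite /= in_itv.
  by have := ax (lift ord0 j); rewrite tc tl.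
have [j ->|->] := unliftP ord0 i; first by rewrite tc tl; exact: hx.
by move: hu; rewrite /= in_itv.
Qed.

Lemma measurable_cube (R : realType) n (a : rspace R n) (l : R) :
  measurable (cube a l).
Proof.
rewrite (_ : cube a l =
    \bigcap_(i in [set: 'I_n]) ((@tnth _ _ ^~ i) @^-1` `[tnth a i, tnth a i + l[)).
  apply: fin_bigcap_measurable => // i _; rewrite -[X in measurable X]setTI.
  exact: measurable_tnth.
apply/seteqP; split=> x /= h i; last by have := h i I; rewrite /= in_itv.
by move=> _ /=; rewrite in_itv; exact: h.
Qed.

(** Normalization of [lebn]. *)
Lemma lebn_cube (R : realType) n (a : rspace R n) (l : R) : 0 <= l ->
  lebn R n (cube a l) = (l ^+ n)%:E.
Proof.
move=> l0; elim: n a => [|n IHn] a.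
  by rewrite cube0 /= /dirac indicE in_setT expr0.
rewrite /= /tuple_product /pushforward cubeS product_measure1E//=; last exact: measurable_cube.
rewrite IHn lebesgue_measure_itv /= lte_fin ltrDl.
case: ltP => [_|l0']; first by rewrite -EFinB addrAC subrr add0r -EFinM exprS.
by rewrite mul0e (_ : l = 0) ?expr0n//; apply/eqP; rewrite eq_le l0 l0'.
Qed.

Section cubes.
Context {R : realType} {n : nat}.
Implicit Types (P Q : set (rspace R n)) (D S : set (set (rspace R n))).

Definition is_cube P := exists a l, 0 < l /\ P = cube a l.

(** [e] selects one of the 2^n subcubes of half the side length. *)
Definition dyadic_child P P' := exists a l (e : 'I_n -> bool),
  [/\ 0 < l, P = cube a l &
      P' = cube [tuple tnth a i + (e i)%:R * (l / 2) | i < n] (l / 2)].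

(** The grid D(P), which contains P itself. *)
Inductive dyadic_grid P : set (set (rspace R n)) :=
| dyadic_grid_refl : dyadic_grid P P
| dyadic_grid_child P1 P2 :
    dyadic_grid P P1 -> dyadic_child P1 P2 -> dyadic_grid P P2.

(** Tuples carry no topology in the library; compactness in R^n is taken from
    the normed space of row vectors. *)
Definition compactn (K : set (rspace R n)) :=
  compact [set (\row_(i < n) (tnth x i : R) : 'rV[R]_n) | x in K].

Definition dyadic_lattice D := [/\ D `<=` is_cube,
  forall P P', D P -> dyadic_grid P P' -> D P',
  forall P1 P2, D P1 -> D P2 ->
    exists P, [/\ D P, dyadic_grid P P1 & dyadic_grid P P2] &
  forall K, compactn K -> exists2 P, D P & K `<=` P].

Definition sparse (eta : R) S := exists E : set (rspace R n) -> set (rspace R n),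
  (forall P, S P ->
    [/\ measurable (E P), E P `<=` P & (eta%:E * lebn R n P <= lebn R n (E P))%E])
  /\ trivIset S E.

End cubes.

Section operators.
Context {R : realType} {n : nat}.
Local Open Scope ereal_scope.
Implicit Types (P : set (rspace R n)) (S : set (set (rspace R n))).
Implicit Types (b f : rspace R n -> R) (g : rspace R n -> \bar R).

Definition avg P g : \bar R := (\int[lebn R n]_(y in P) g y) / lebn R n P.

Definition mean b P : \bar R := avg P (EFin \o b).

Definition osc b P (x : rspace R n) : \bar R := `|(b x)%:E - mean b P|.

(** In [\bar R], [0^-1 = +oo]; so [expeR (- (t%:E / bmo_norm b)) = 0] for t > 0
    and b constant almost everywhere. *)
Definition bmo_norm b : \bar R :=
  ereal_sup [set avg P (osc b P) | P in is_cube].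

Definition bmo b := [/\ measurable_fun setT b,
  (forall P, is_cube P -> (lebn R n).-integrable P (EFin \o b)) &
  bmo_norm b < +oo].

(** Uncentered; it acts on extended functions so that it can be iterated. *)
Definition maximal g (x : rspace R n) : \bar R :=
  ereal_sup [set avg P (abse \o g) | P in [set P | is_cube P /\ P x]].

Definition sparse_A (r : R) S f (x : rspace R n) : \bar R :=
  (\esum_(P in S) (avg P (fun y => `|f y|%:E) `^ r * (\1_P x)%:E)) `^ r^-1.

Definition sparse_T S b f (x : rspace R n) : \bar R :=
  \esum_(P in S) (osc b P x * avg P (fun y => `|f y|%:E) * (\1_P x)%:E).

Definition sparse_Tstar S b f (x : rspace R n) : \bar R :=
  \esum_(P in S) (avg P (fun y => osc b P y * `|f y|%:E) * (\1_P x)%:E).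

End operators.

(* Main.v *)
Require Import Defs.
From mathcomp Require Import all_boot all_order all_algebra.
From mathcomp Require Import all_classical all_reals all_analysis.
From mathcomp Require Import measurable_realfun ring lra zify.
Import Order.TTheory GRing.Theory Num.Theory.
Import numFieldNormedType.Exports.
Local Open Scope classical_set_scope.
Local Open Scope ring_scope.

(** Fix [x] in [Q]. The cubes of the sparse family [S] that contain [x] are of two
    kinds.

    A cube [P] at least as large as [Q] has [avg P |f| <= (vol Q / vol P) * Mf x],
    because [f] vanishes outside [Q], and a dyadic lattice has at most one such
    cube containing [x] at each scale ([dyadic_gap_inj]). The large cubes
    therefore contribute at most a convergent geometric series times [Mf x].

    A cube [P] smaller than [Q] has [avg P |f| <= Mf x], so the small cubes
    contribute at most [Mf x] times their number. That number has an exponential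
    tail on [Q] ([overlap_decay]): add the cubes of a finite subfamily from the
    smallest to the largest and follow the integral of [w ^ number]. A new cube
    [P] adds [w - 1] times the integral over [P] of the exponential of the smaller
    cubes, which by packing is at most [2 * vol P] when [w - 1] is small compared
    with [eta / 3 ^ n]. This proves the estimate for [sparse_A]
    ([sparse_A_decay]).

    For the commutator operators let [c] be the mean of [b] over the threefold
    dilate of [Q], and let [beta] bound the mean oscillations of [b]. Stopping at
    the first dyadic subcubes where [|b - b_P|] has average above [2 * beta] loses
    at most half of [P], leaves [|b - b_P|] bounded by a multiple of [beta]
    almost everywhere outside the stopping cubes, and changes the mean by at most
    such a multiple. Iterating this decomposition gives both the John-Nirenberg
    inequality ([john_nirenberg]) and
    [avg P (|b - b_P| |f|) <= C * beta * M (M f) x] for [x] in [P]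
    ([weighted_oscillation]): each generation costs the integral of [|f|] over a
    stopping cube, which is controlled by the maximal function on the half of
    that cube where nothing stops. The second bound makes [sparse_Tstar] behave
    like the counting function of the first estimate.

    For [sparse_T], use [|b x - b_P| <= |b x - c| + |b_P - c|]. Outside a subset
    of [Q] of relative measure at most a constant times [exp (- d * y)], the
    number of small cubes containing [x] is at most [y] ([overlap_decay]), and
    [|b x - c|] and all [|b_P - c|], with [P] small and containing [x], are at
    most [y * beta] ([john_nirenberg] and [mean_decay]). There the two operators
    are at most a constant times [beta * y ^ 2] times [M (M f) x]
    ([sparse_T_decay]); taking [y] proportional to [sqrt (t / beta)] explains the
    square root in the exponent. *)

Set Implicit Arguments.
Unset Strict Implicit.
Unset Printing Implicit Defensive.

(** * Integrals and measures of arbitrary sets *)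

Local Open Scope ereal_scope.

(** The integral of a nonnegative function is a supremum over the simple
    functions below it, hence monotone without any measurability; this allows
    the maximal function to be integrated as it stands. *)
Lemma ge0_integral_mono d (T : measurableType d) (R : realType)
    (mu : {measure set T -> \bar R}) (D E : set T) (f g : T -> \bar R) :
  D `<=` E -> (forall x, E x -> 0 <= g x) ->
  (forall x, D x -> 0 <= f x) -> (forall x, D x -> f x <= g x) ->
  \int[mu]_(x in D) f x <= \int[mu]_(x in E) g x.
Proof.
move=> DE g0 f0 fg; rewrite !ge0_integralE//.
apply: ereal_sup_le => _ [h /= hf <-]; exists h => // x.
apply: (le_trans (hf x)); rewrite !patchE.
have [xD|xD] := pselect (D x).
  by rewrite !mem_set//; [exact: fg|exact: DE].
by rewrite memNset//; case: ifP => // /set_mem/g0.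
Qed.

(** By induction on the dimension, the measure of any set is an iterated integral
    of indicator functions. The level sets of the operators can thus be compared
    with measurable sets directly. *)
Lemma lebn_mono (R : realType) n (A B : set (rspace R n)) :
  A `<=` B -> lebn R n A <= lebn R n B.
Proof.
elim: n A B => [|n IHn] A B AB.
  rewrite /= /dirac !indicE lee_fin ler_nat.
  by case: (boolP (_ \in A)) => // /set_mem/AB/mem_set ->.
apply: ge0_integral_mono => // x _.
apply: IHn => y; rewrite /xsection/= !inE; exact: AB.
Qed.

Section fibers.
Context d (T : measurableType d) (R : realType) (mu : {measure set T -> \bar R}).

Lemma ge0_le_integral_fibers (I : countType) (phi : T -> I) (B : set T)
    (h1 h2 : T -> \bar R) :
  (forall i, measurable (B `&` phi @^-1` [set i])) ->
  (forall x, 0 <= h1 x) -> (forall x, 0 <= h2 x) ->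
  measurable_fun setT h1 -> measurable_fun setT h2 ->
  (forall i, \int[mu]_(x in B `&` phi @^-1` [set i]) h1 x <=
             \int[mu]_(x in B `&` phi @^-1` [set i]) h2 x) ->
  \int[mu]_(x in B) h1 x <= \int[mu]_(x in B) h2 x.
Proof.
move=> mB h10 h20 mh1 mh2 le12.
have fibE k : (exists i, (pickle \o phi) @^-1` [set k] = phi @^-1` [set i]) \/
    (pickle \o phi) @^-1` [set k] = set0.
  have [[x px]|nx] := pselect (exists x, pickle (phi x) = k).
    left; exists (phi x); apply/seteqP; split=> y /= => [|->//].
    by rewrite -px => /(pcan_inj pickleK).
  by right; apply/seteqP; split=> // x /= px; apply: nx; exists x.
have BE : B = \bigcup_k (B `&` (pickle \o phi) @^-1` [set k]).
  by apply/seteqP; split=> [x Bx|x [k _ []//]]; exists (pickle (phi x)).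
have mF k : measurable (B `&` (pickle \o phi) @^-1` [set k]).
  by case: (fibE k) => [[i ->]//|->]; rewrite setI0.
have tF : trivIset setT (fun k => B `&` (pickle \o phi) @^-1` [set k]).
  by move=> i j _ _ [x /= [[_ <-] [_ <-]]].
rewrite BE !ge0_integral_bigcup//; last 2 first.
- exact: measurable_funTS.
- exact: measurable_funTS.
apply: lee_nneseries => [k _ _|k _]; first by apply: integral_ge0.
by case: (fibE k) => [[i ->]//|->]; rewrite setI0 !integral_set0.
Qed.

End fibers.

Local Close Scope ereal_scope.

(** * Dyadic grids *)

Section grid.
Context {R : realType} {n : nat}.
Variables (a : rspace R n) (l : R).
Hypothesis l0 : 0 < l.
Notation mu := (lebn R n).

Definition mesh (j : nat) : R := l / 2 ^+ j.

Definition grid_index (j : nat) (x : rspace R n) : {ffun 'I_n -> int} :=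
  [ffun i => Num.floor ((tnth x i - tnth a i) / mesh j)].

Definition corner (j : nat) (m : {ffun 'I_n -> int}) : rspace R n :=
  [tuple tnth a i + (m i)%:~R * mesh j | i < n].

Lemma mesh_gt0 j : 0 < mesh j.
Proof. by rewrite divr_gt0// exprn_gt0. Qed.

Lemma meshS j : mesh j = 2 * mesh j.+1.
Proof.
by rewrite /mesh exprS; field; rewrite expf_neq0.
Qed.

Lemma grid_cellE j m : grid_index j @^-1` [set m] = cube (corner j m) (mesh j).
Proof.
have h0 := mesh_gt0 j.
apply/seteqP; split=> [x <- i|x mx].
  rewrite tnth_mktuple ffunE.
  have /andP[] := floor_itv ((tnth x i - tnth a i) / mesh j).
  rewrite ler_pdivlMr// ltr_pdivrMr// intrD mulrDl; lra.
apply/ffunP => i; rewrite ffunE; apply: floor_def.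
have := mx i; rewrite tnth_mktuple => /andP[].
by rewrite ler_pdivlMr// ltr_pdivrMr// intrD mulrDl; lra.
Qed.

Lemma measurable_grid_cell j m : measurable (grid_index j @^-1` [set m]).
Proof. by rewrite grid_cellE; exact: measurable_cube. Qed.

Lemma is_cube_grid_cell j m : is_cube (grid_index j @^-1` [set m]).
Proof. by rewrite grid_cellE; exists (corner j m), (mesh j); rewrite mesh_gt0. Qed.

Lemma lebn_grid_cell j m : mu (grid_index j @^-1` [set m]) = (mesh j ^+ n)%:E.
Proof. by rewrite grid_cellE lebn_cube// ltW// mesh_gt0. Qed.

Lemma measurable_grid_preimage j M : measurable (grid_index j @^-1` M).
Proof.
rewrite (_ : _ @^-1` M =
    \bigcup_(m in [set: {ffun 'I_n -> int}]) (grid_index j @^-1` ([set m] `&` M))).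
  apply: countable_bigcupT_measurable => [|m]; first exact: countableP.
  have [Mm|Mm] := pselect (M m).
    rewrite (_ : _ `&` _ = [set m]); first exact: measurable_grid_cell.
    by apply/seteqP; split=> [? []//|? ->].
  rewrite (_ : _ `&` _ = set0) ?preimage_set0//.
  by apply/seteqP; split=> // ? [/= ->].
by apply/seteqP; split=> [x Mx|x [m _ []//]]; exists (grid_index j x).
Qed.

Lemma grid_index_refine j k x y : (j <= k)%N ->
  grid_index k x = grid_index k y -> grid_index j x = grid_index j y.
Proof.
elim: k => [|k IHk]; first by rewrite leqn0 => /eqP ->.
rewrite leq_eqVlt => /orP[/eqP -> //|jk e]; apply: IHk => //.
apply/ffunP => i; move/ffunP : e => /(_ i); rewrite !ffunE (meshS k).
have h0 := mesh_gt0 k.+1.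
set u := tnth x i - _; set v := tnth y i - _ => e.
have /andP[] := floor_itv (u / (2 * mesh k.+1)).
set p := Num.floor (u / (2 * mesh k.+1)).
rewrite ler_pdivlMr ?ltr_pdivrMr ?mulr_gt0// intrD => pu1 pu2.
have p1 : 2 * p <= Num.floor (u / mesh k.+1).
  by rewrite floor_ge_int ler_pdivlMr// intrM; lra.
have p2 : Num.floor (u / mesh k.+1) < 2 * p + 2.
  by rewrite floor_lt_int ltr_pdivrMr// intrD intrM; lra.
have /andP[] := floor_itv (v / mesh k.+1); rewrite -e.
set q := Num.floor (u / mesh k.+1) in p1 p2 *.
rewrite ler_pdivlMr ?ltr_pdivrMr// intrD => qv1 qv2.
have {}p1 : (2 * p)%:~R <= q%:~R :> R by rewrite ler_int.
have {}p2 : (q + 1)%:~R <= (2 * p + 2)%:~R :> R by rewrite ler_int; lia.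
rewrite !intrD !intrM in p1 p2.
apply/esym/floor_def; rewrite ler_pdivlMr ?ltr_pdivrMr ?mulr_gt0// intrD.
by apply/andP; split; nra.
Qed.

(** Unions of cells of one generation are also unions of cells of any later one,
    so finitely many of them can be brought to a common generation. *)
Lemma grid_preimage_refine j k M : (j <= k)%N ->
  exists M', grid_index j @^-1` M = grid_index k @^-1` M'.
Proof.
move=> jk; exists (grid_index k @` (grid_index j @^-1` M)).
apply/seteqP; split=> [x Mx|x [y My yx]]; first by exists x.
by rewrite /preimage /= -(grid_index_refine jk yx).
Qed.

Section approximation.
Variable P : set (rspace R n).
Hypotheses (mP : measurable P) (Poo : (mu P < +oo)%E).

(** Working with unions of cells of a single generation, rather than with open
    sets, makes the class trivially stable under complement, hence a
    sigma-algebra. *)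
Definition grid_approx (A : set (rspace R n)) := measurable A /\
  forall e : R, 0 < e -> exists j M, let B := grid_index j @^-1` M in
    (mu (P `&` (A `\` B `|` B `\` A)) <= e%:E)%E.

Lemma grid_approxC A : grid_approx A -> grid_approx (~` A).
Proof.
move=> [mA hA]; split; first exact: measurableC.
move=> e /hA[j [M h]]; exists j, (~` M); rewrite /= preimage_setC.
by rewrite !setDE !setCK (setIC (~` A)) (setIC _ A) setUC -!setDE.
Qed.

Lemma grid_approxU A1 A2 : grid_approx A1 -> grid_approx A2 ->
  grid_approx (A1 `|` A2).
Proof.
move=> [mA1 h1] [mA2 h2]; split; first exact: measurableU.
move=> e e0; have e20 : 0 < e / 2 by rewrite divr_gt0.
have [j1 [M1 /= {}h1]] := h1 _ e20; have [j2 [M2 /= {}h2]] := h2 _ e20.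
have [M1' e1] := grid_preimage_refine M1 (leq_maxl j1 j2).
have [M2' e2] := grid_preimage_refine M2 (leq_maxr j1 j2).
exists (maxn j1 j2), (M1' `|` M2'); rewrite /= preimage_setU -e1 -e2.
have mB j M := measurable_grid_preimage j M.
apply: (@le_trans _ _ (mu ((P `&`
    (A1 `\` grid_index j1 @^-1` M1 `|` grid_index j1 @^-1` M1 `\` A1)) `|` (P `&`
    (A2 `\` grid_index j2 @^-1` M2 `|` grid_index j2 @^-1` M2 `\` A2))))).
  by apply: lebn_mono => x /=; tauto.
have mD A j M : measurable A -> measurable (P `&`
    (A `\` grid_index j @^-1` M `|` grid_index j @^-1` M `\` A)).
  by move=> mA; apply: measurableI => //; apply: measurableU; exact: measurableD.
apply: (le_trans (measureU2 _ (mD _ _ _ mA1) (mD _ _ _ mA2))).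
by rewrite [e]splitr EFinD; exact: leeD.
Qed.

Lemma grid_approx0 : grid_approx set0.
Proof.
split=> // e e0; exists 0%N, set0.
by rewrite /= preimage_set0 !setD0 setU0 setI0 measure0 lee_fin ltW.
Qed.

(** Finite unions exhaust the countable one up to a small part of [P], and are
    themselves approximable. *)
Lemma grid_approx_bigcup (A : (set (rspace R n))^nat) :
  (forall k, grid_approx (A k)) -> grid_approx (\bigcup_k A k).
Proof.
move=> hA; have mA k : measurable (A k) by case: (hA k).
split; first exact: bigcup_measurable.
move=> e e0; have e20 : 0 < e / 2 by rewrite divr_gt0.
pose U k := \big[setU/set0]_(i < k) A i.
have hU k : grid_approx (U k).
  rewrite /U; elim: k => [|k IHk]; first by rewrite big_ord0; exact: grid_approx0.
  by rewrite big_ord_recr; exact: grid_approxU.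
have mU k : measurable (U k) by case: (hU k).
pose F k := P `&` (\bigcup_i A i `\` U k).
have mF k : measurable (F k).
  by apply: measurableI => //; apply: measurableD => //; exact: bigcup_measurable.
have F0 : \bigcap_k F k = set0.
  apply/seteqP; split=> // x Fx; have [_ [[i _ Aix] _]] := Fx 0%N I.
  have [_ [_]] := Fx i.+1 I; apply.
  by rewrite /U -bigcup_mkord; exists i => //=.
have : mu \o F @ \oo --> mu (\bigcap_k F k).
  apply: nonincreasing_cvg_mu => //.
  - by apply: (le_lt_trans _ Poo); apply: lebn_mono => x [].
  - by rewrite F0.
  - move=> k1 k2 k12; apply/subsetPset => x [Px [Ax Ux]]; do 2 split => //.
    apply: contra_not Ux; rewrite /U -!bigcup_mkord => -[i /= ik Aix].
    by exists i => //=; exact: leq_trans k12.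
rewrite F0 measure0 => /fine_cvgP[_ /cvgrPdist_lt/(_ _ e20)[K _ /(_ K (leqnn _))]].
rewrite /= sub0r normrN => FK.
have {}FK : (mu (F K) <= (e / 2)%:E)%E.
  have fF : mu (F K) \is a fin_num.
    rewrite ge0_fin_numE//; apply: (le_lt_trans _ Poo).
    by apply: lebn_mono => x [].
  by rewrite -(fineK fF) lee_fin; apply/ltW/(le_lt_trans (ler_norm _)).
have [_ /(_ _ e20)[j [M /= hM]]] := hU K.
exists j, M => /=; set B := grid_index j @^-1` M in hM *.
have mB : measurable B by exact: measurable_grid_preimage.
apply: (@le_trans _ _ (mu (F K `|` (P `&` (U K `\` B `|` B `\` U K))))).
  apply: lebn_mono => x /= [Px [[Ax Bx]|[Bx Ax]]].
    by have [Ux|Ux] := pselect (U K x); [right|left]; split=> //; left.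
  right; split=> //; right; split=> //; apply: contra_not Ax.
  by rewrite /U -bigcup_mkord => -[k _ Akx]; exists k.
rewrite [e]splitr EFinD; apply: le_trans (leeD FK hM).
by apply: measureU2 => //; apply: measurableI => //; apply: measurableU;
  exact: measurableD.
Qed.

(** The cells that meet a half-space cover it with an excess that lies in a slab of
    width [mesh k], and these slabs decrease to the empty set. *)
Lemma grid_approx_ray i c : grid_approx ((@tnth _ _ ^~ i) @^-1` `[c, +oo[).
Proof.
split; first by rewrite -[X in measurable X]setTI; exact: measurable_tnth.
move=> e e0.
pose F k := P `&` (@tnth _ _ ^~ i) @^-1` `[c - mesh k, c[.
have mF k : measurable (F k).
  apply: measurableI => //; rewrite -[X in measurable X]setTI.
  exact: measurable_tnth.
have mesh_small (d : R) : 0 < d -> exists k, mesh k < d.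
  move=> d0; exists (Num.bound (l / d)); rewrite /mesh ltr_pdivrMr ?exprn_gt0//.
  rewrite mulrC -ltr_pdivrMr//.
  apply: (lt_le_trans (archi_boundP _)); first by rewrite ltW ?divr_gt0.
  by rewrite -natrX ler_nat ltnW// ltn_expl.
have F0 : \bigcap_k F k = set0.
  apply/seteqP; split=> // x Fx.
  have xc : tnth x i < c by have [_ /=] := Fx 0%N I; rewrite in_itv/= => /andP[].
  have [|k kx] := mesh_small (c - tnth x i); first by rewrite subr_gt0.
  by have [_ /=] := Fx k I; rewrite in_itv/= => /andP[? _]; lra.
have : mu \o F @ \oo --> mu (\bigcap_k F k).
  apply: nonincreasing_cvg_mu => //.
  - by apply: (le_lt_trans _ Poo); apply: lebn_mono => x [].
  - by rewrite F0.
  - move=> k1 k2 k12; apply/subsetPset => x [Px]; split => //; move: b => /=.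
    rewrite !in_itv/= => /andP[h ->]; rewrite andbT.
    apply: le_trans h; rewrite lerD2l lerN2 /mesh ler_pM2l// lef_pV2 ?posrE ?exprn_gt0//.
    by rewrite ler_weXn2l// ler1n.
rewrite F0 measure0 => /fine_cvgP[_ /cvgrPdist_lt/(_ _ e0)[K _ /(_ K (leqnn _))]].
rewrite /= sub0r normrN => FK.
have {}FK : (mu (F K) <= e%:E)%E.
  have fF : mu (F K) \is a fin_num.
    rewrite ge0_fin_numE//; apply: (le_lt_trans _ Poo).
    by apply: lebn_mono => x [].
  by rewrite -(fineK fF) lee_fin; apply/ltW/(le_lt_trans (ler_norm _)).
have hK := mesh_gt0 K.
exists K, [set m : {ffun 'I_n -> int} | Num.floor ((c - tnth a i) / mesh K) <= m i].
apply: le_trans FK; apply: lebn_mono => x /= [Px].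
rewrite /preimage/= ffunE !in_itv/= !andbT.
rewrite floor_ge_int ler_pdivlMr//.
have := floor_itv ((c - tnth a i) / mesh K).
rewrite ler_pdivlMr ?ltr_pdivrMr// intrD => /andP[c1 c2].
move=> [[cx] []|[cx /negP]]; first by lra.
rewrite -ltNge => xc; split=> //=; rewrite in_itv/= xc andbT; lra.
Qed.

Lemma measurable_grid_approx A : measurable A -> grid_approx A.
Proof.
have sa : sigma_algebra setT grid_approx.
  split; first exact: grid_approx0.
  - by move=> B /grid_approxC; rewrite setTD.
  - exact: grid_approx_bigcup.
apply: smallest_sub => //.
apply: (@big_ind _ (fun F => F `<=` grid_approx)) => // [F G hF hG B [/hF//|/hG//]|i _].
move=> _ [Y mY <-]; rewrite setTI.
pose H := [set Y : set R | grid_approx ((@tnth _ _ ^~ i) @^-1` Y)].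
have {mY} : (@ocitv R).-sigma.-measurable Y by [].
rewrite RGenCInfty.measurableE.
suff hH : (@RGenCInfty.G R).-sigma.-measurable `<=` H by move=> /hH.
apply: smallest_sub => [|_ [c ->]]; last exact: grid_approx_ray.
split=> [|B|B hB]; rewrite /H/= ?preimage_set0 ?preimage_bigcup.
- exact: grid_approx0.
- by move/grid_approxC; rewrite setTD preimage_setC.
- exact: grid_approx_bigcup.
Qed.

End approximation.

Lemma grid_cell_nested i j m m' : (i <= j)%N ->
  let P := grid_index i @^-1` [set m] in let C := grid_index j @^-1` [set m'] in
  C `<=` P \/ P `&` C = set0.
Proof.
move=> ij P C; have [[x [Px Cx]]|nPC] := pselect (exists x, P x /\ C x).
  by left => y Cy; rewrite /P/= -Px; apply: grid_index_refine ij _; rewrite Cy Cx.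
by right; apply/seteqP; split=> // x [Px Cx]; apply: nPC; exists x.
Qed.

(** A weak form of the Lebesgue density theorem. If [B] is a union of cells of one
    generation that differs from [A] by little inside [P], then [A] fills at most
    half of [P `&` B], although it is almost all of it. *)
Lemma grid_density i m A : measurable A ->
  let P := grid_index i @^-1` [set m] in
  (forall j m', (i <= j)%N -> let C := grid_index j @^-1` [set m'] in
    C `<=` P -> (mu (A `&` C) <= 2^-1%:E * mu C)%E) ->
  mu (A `&` P) = 0%E.
Proof.
move=> mA P hA.
have mP : measurable P by exact: measurable_grid_cell.
have Poo : (mu P < +oo)%E by rewrite lebn_grid_cell ltry.
have finP D : mu (P `&` D) \is a fin_num.
  by rewrite ge0_fin_numE//; apply: (le_lt_trans _ Poo); apply: lebn_mono => x [].
apply/eqP; rewrite eq_le measure_ge0 andbT; apply/lee_addgt0Pr => e e0.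
rewrite add0e; have e30 : 0 < e / 3 by rewrite divr_gt0.
have [_ /(_ _ e30)[j0 [M0 /=]]] := measurable_grid_approx mP Poo mA.
have [M ->] := grid_preimage_refine M0 (leq_maxr i j0).
set j := maxn i j0; set B := grid_index j @^-1` M => hB.
have mB : measurable B by exact: measurable_grid_preimage.
have half : (mu (P `&` (A `&` B)) <= 2^-1%:E * mu (P `&` B))%E.
  rewrite [X in mu X](_ : _ = A `&` (P `&` B)); last by rewrite setICA.
  rewrite -integral_indic//; last exact: measurableI.
  rewrite [leRHS](_ : _ = \int[mu]_(x in P `&` B) (cst 2^-1%:E) x)%E; last first.
    by rewrite integral_cst//; exact: measurableI.
  apply: (@ge0_le_integral_fibers _ _ _ _ _ (grid_index j)) => //.
  - by move=> m'; apply: measurableI; [exact: measurableI|exact: measurable_grid_cell].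
  - by move=> x; rewrite lee_fin.
  - exact/measurable_EFinP/measurable_indic.
  - move=> m'; have [CP|PC0] := grid_cell_nested m m' (leq_maxl i j0); last first.
      by rewrite setIAC PC0 set0I !integral_set0.
    have [Mm|Mm] := pselect (M m'); last first.
      rewrite (_ : _ `&` _ = set0) ?integral_set0//.
      by apply/seteqP; split=> // x [[_ Bx]] /= xm; apply: Mm; rewrite -xm.
    rewrite (_ : P `&` B `&` _ = grid_index j @^-1` [set m']); last first.
      apply/seteqP; split=> [x [_ xm]//|x xm]; split=> //; split; first exact: CP.
      by rewrite /B /preimage/= xm.
    rewrite integral_cst ?integral_indic//; try exact: measurable_grid_cell.
    by apply: hA => //; exact: leq_maxl.
have step : (mu (P `&` B) <= mu (P `&` (A `&` B)) + (e / 3)%:E)%E.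
  apply: le_trans (leeD (lexx _) hB).
  apply: (@le_trans _ _ (mu ((P `&` (A `&` B)) `|` (P `&` (A `\` B `|` B `\` A))))).
    by apply: lebn_mono => x /= [Px Bx]; have [] := pselect (A x); tauto.
  by apply: measureU2; apply: measurableI => //; [exact: measurableI|
    apply: measurableU; exact: measurableD].
have last : (mu (A `&` P) <= mu (P `&` (A `&` B)) + (e / 3)%:E)%E.
  apply: le_trans (leeD (lexx _) hB).
  apply: (@le_trans _ _ (mu ((P `&` (A `&` B)) `|` (P `&` (A `\` B `|` B `\` A))))).
    by apply: lebn_mono => x /= [Ax Px]; have [] := pselect (B x); tauto.
  by apply: measureU2; apply: measurableI => //; [exact: measurableI|
    apply: measurableU; exact: measurableD].
move: half step last; rewrite -(fineK (finP B)) -(fineK (finP (A `&` B))).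
by rewrite (setIC A P) -(fineK (finP A)) -!EFinM -!EFinD !lee_fin; lra.
Qed.

End grid.

(** * Averages and mean oscillation *)

Section averages.
Context {R : realType} {n : nat}.
Notation mu := (lebn R n).
Implicit Types (P Q : set (rspace R n)) (b : rspace R n -> R).
Implicit Types g : rspace R n -> \bar R.

Definition vol P : R := fine (mu P).

Lemma measurable_is_cube P : is_cube P -> measurable P.
Proof. by move=> [a [l [_ ->]]]; exact: measurable_cube. Qed.

Lemma lebn_is_cube P : is_cube P -> mu P = (vol P)%:E.
Proof. by move=> [a [l [l0 ->]]]; rewrite /vol lebn_cube ?ltW. Qed.

Lemma vol_gt0 P : is_cube P -> 0 < vol P.
Proof. by move=> [a [l [l0 ->]]]; rewrite /vol lebn_cube ?ltW ?exprn_gt0. Qed.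

Lemma avgE P g : is_cube P ->
  avg P g = ((vol P)^-1%:E * \int[mu]_(x in P) g x)%E.
Proof.
move=> cP; by rewrite /avg lebn_is_cube// inver gt_eqF ?vol_gt0// muleC.
Qed.

Lemma integral_avgE P g : is_cube P ->
  (\int[mu]_(x in P) g x = (vol P)%:E * avg P g)%E.
Proof.
move=> cP; rewrite avgE// muleA -EFinM divff ?mul1e//.
by rewrite gt_eqF// vol_gt0.
Qed.

Lemma integral_cst_cube P k : is_cube P ->
  (\int[mu]_(x in P) cst k x = (vol P)%:E * k)%E.
Proof.
move=> cP; rewrite integral_cst; last exact: measurable_is_cube.
by rewrite muleC; congr (_ * _)%E; exact: lebn_is_cube.
Qed.

Lemma avg_cst P k : is_cube P -> avg P (cst k) = k.
Proof.
move=> cP; rewrite avgE// integral_cst_cube// muleA -EFinM mulVf ?mul1e//.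
by rewrite gt_eqF// vol_gt0.
Qed.

Lemma avg_ge0 P g : (forall x, P x -> 0 <= g x)%E -> (0 <= avg P g)%E.
Proof.
move=> g0; rewrite /avg mule_ge0 ?integral_ge0//.
by rewrite inve_ge0.
Qed.

Lemma le_avg P g1 g2 : (forall x, P x -> 0 <= g1 x)%E ->
  (forall x, P x -> g1 x <= g2 x)%E -> (avg P g1 <= avg P g2)%E.
Proof.
move=> g0 g12; rewrite /avg lee_wpmul2r ?inve_ge0//.
by apply: ge0_integral_mono => // x Px; exact: le_trans (g0 _ Px) (g12 _ Px).
Qed.

Lemma avg_le P g (k : \bar R) : is_cube P ->
  (avg P g <= k)%E = (\int[mu]_(x in P) g x <= (vol P)%:E * k)%E.
Proof. by move=> cP; rewrite integral_avgE// lee_pmul2l// lte_fin vol_gt0. Qed.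

Lemma le_avg_maximal P g x : is_cube P -> P x ->
  (avg P (abse \o g) <= maximal g x)%E.
Proof. by move=> cP Px; apply: ereal_sup_ubound; exists P. Qed.

Lemma maximal_ge0 g x : (0 <= maximal g x)%E.
Proof.
have Px : cube x 1 x by move=> i; rewrite lexx ltrDl ltr01.
have cP : is_cube (cube x 1) by exists x, 1.
by apply: (le_trans _ (le_avg_maximal g cP Px)); apply: avg_ge0 => z _ /=.
Qed.

(** Averages over a cube never exceed the minimum over that cube of the maximal
    function, so they survive a second application of the maximal operator. *)
Lemma le_avg_maximal2 P g x : is_cube P -> P x ->
  (avg P (abse \o g) <= maximal (maximal g) x)%E.
Proof.
move=> cP Px; apply: (le_trans _ (le_avg_maximal _ cP Px)).
rewrite -[leLHS](avg_cst _ cP).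
apply: le_avg => y Py /=; first by apply: avg_ge0 => z _; exact: abse_ge0.
by rewrite gee0_abs ?maximal_ge0//; exact: le_avg_maximal.
Qed.

Lemma markov_set g A P (s : R) : measurable A -> measurable P -> 0 <= s ->
  (forall x, P x -> 0 <= g x)%E -> (forall x, A x -> P x -> s%:E <= g x)%E ->
  (s%:E * mu (A `&` P) <= \int[mu]_(x in P) g x)%E.
Proof.
move=> mA mP s0 g0 sg; rewrite -integral_cst//; last exact: measurableI.
by apply: ge0_integral_mono => // x [Ax Px]; exact: sg.
Qed.

Definition rmean b P : R := fine (mean b P).

(** A real bound instead of the norm itself: when the norm is [0], the estimates
    below are applied with arbitrarily small positive bounds. *)
Definition bmo_le b (beta : R) := [/\ measurable_fun setT b,
  forall P, is_cube P -> mu.-integrable P (EFin \o b) &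
  forall P, is_cube P -> (avg P (osc b P) <= beta%:E)%E].

Variables (b : rspace R n -> R) (beta : R).
Hypothesis hb : bmo_le b beta.

Let mb : measurable_fun setT b. Proof. by case: hb. Qed.

Lemma mean_rmean P : is_cube P -> mean b P = (rmean b P)%:E.
Proof.
case: hb => _ ib _ cP; rewrite /rmean fineK// /mean avgE//.
rewrite fin_numM//; apply: integrable_fin_num; last exact: ib.
exact: measurable_is_cube.
Qed.

Lemma oscE P x : is_cube P -> osc b P x = `|b x - rmean b P|%:E.
Proof. by move=> cP; rewrite /osc mean_rmean// -EFinB abse_EFin. Qed.

Lemma measurable_dist c : measurable_fun setT (fun x => `|b x - c|%:E).
Proof.
apply/measurable_EFinP; apply: measurableT_comp => //.
by apply: measurable_funB => //; exact: measurable_cst.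
Qed.

Lemma measurable_dist_gt c s : measurable [set x | s < `|b x - c|].
Proof.
rewrite (_ : mkset _ = (fun x => `|b x - c|) @^-1` `]s, +oo[); last first.
  by apply/seteqP; split=> x /=; rewrite in_itv/= andbT.
rewrite -[X in measurable X]setTI; have /measurable_EFinP := measurable_dist c.
exact.
Qed.

Lemma integral_dist_rmean P : is_cube P ->
  (\int[mu]_(x in P) `|b x - rmean b P|%:E <= (beta * vol P)%:E)%E.
Proof.
case: hb => _ _ ob cP; have := ob _ cP; rewrite avg_le// muleC -EFinM.
by under eq_integral do rewrite oscE//.
Qed.

Lemma rmean_dist P Q c (K : R) : is_cube P -> is_cube Q -> P `<=` Q ->
  (\int[mu]_(x in Q) `|b x - c|%:E <= K%:E)%E ->
  `|rmean b P - c| <= K / vol P.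
Proof.
move=> cP cQ PQ hK; have [_ ib _] := hb.
have vP := vol_gt0 cP; have mP := measurable_is_cube cP.
have mQ := measurable_is_cube cQ.
have ic : mu.-integrable P (cst c%:E).
  apply/integrableP; split; first exact: measurable_cst.
  rewrite [X in (X < _)%E](_ : _ = \int[mu]_(x in P) cst `|c|%:E x)%E//.
  by rewrite integral_cst_cube// -EFinM ltry.
rewrite ler_pdivlMr//.
have e : ((rmean b P - c) * vol P)%:E = (\int[mu]_(x in P) (b x - c)%:E)%E.
  under eq_integral do rewrite EFinB.
  rewrite integralB//=; last exact: ib.
  rewrite (integral_cst_cube c%:E)// (integral_avgE (EFin \o b))// -/(mean b P) mean_rmean//.
  by rewrite -!EFinM -EFinB mulrBl ![vol P * _]mulrC.
rewrite -(gtr0_norm vP) -normrM -lee_fin; apply: le_trans hK.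
rewrite -abse_EFin e.
apply: (le_trans (le_abse_integral _ _ _)) => //.
  by apply: measurable_funTS; apply/measurable_EFinP; apply: measurable_funB.
by apply: ge0_integral_mono => // x _; rewrite lee_fin.
Qed.

Lemma rmean_dist_cubes P Q : is_cube P -> is_cube Q -> P `<=` Q ->
  `|rmean b P - rmean b Q| <= beta * vol Q / vol P.
Proof. by move=> cP cQ /rmean_dist; apply => //; exact: integral_dist_rmean. Qed.

End averages.

(** * Stopping cubes for a function of bounded mean oscillation *)

Section stopping.
Context {R : realType} {n : nat}.
Variables (a : rspace R n) (l : R).
Hypotheses (n_gt0 : (0 < n)%N) (l0 : 0 < l).
Notation mu := (lebn R n).
Notation cell j m := (grid_index a l j @^-1` [set m]).

Variables (b : rspace R n -> R) (beta : R).
Hypotheses (hb : bmo_le b beta) (beta0 : 0 < beta).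

(** Averages over a stopping cell exceed those over its parent by at most the
    factor [2 ^ n], and the average over the parent is at most [2 * beta]. *)
Definition stop_const : R := 2 ^+ n.+1.

Lemma stop_const_ge4 : 4 <= stop_const.
Proof.
rewrite /stop_const -(prednK n_gt0) !exprS mulrA.
have : 1 <= (2 : R) ^+ n.-1 by rewrite exprn_ege1// ler1n.
lra.
Qed.

Variables (i : nat) (m : {ffun 'I_n -> int}).
Let P := cell i m.
Let cP : is_cube P. Proof. exact: is_cube_grid_cell. Qed.
Let mP : measurable P. Proof. exact: measurable_is_cube. Qed.
Let c := rmean b P.
Let g x := `|b x - c|.

Definition above j x : Prop :=
  ((2 * beta)%:E < avg (cell j (grid_index a l j x)) (EFin \o g))%E.

Let stopping x (j : nat) : bool := `[< (i <= j)%N /\ above j x >].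

(** One map with countably many values records all stopping cells at once, so that
    integrals over [P] can be compared fiber by fiber. *)
Definition first_stop x : option (nat * {ffun 'I_n -> int}) :=
  if pselect (exists j, stopping x j) is left h
  then Some (ex_minn h, grid_index a l (ex_minn h) x) else None.

Let first_stopE x j m' : first_stop x = Some (j, m') <->
  [/\ grid_index a l j x = m', stopping x j &
      forall k, stopping x k -> (j <= k)%N].
Proof.
rewrite /first_stop; case: pselect => [h|h]; last first.
  by split=> // -[_ xj _]; case: h; exists j.
case: ex_minnP => k xk kmin; split=> [[<- <-]//|[<- xj jmin]].
by have -> : k = j by apply/eqP; rewrite eqn_leq kmin// jmin.
Qed.

Let stopping_cell x y j k : (k <= j)%N ->
  grid_index a l j x = grid_index a l j y -> stopping x k = stopping y k.
Proof.
by move=> kj e; rewrite /stopping /above (grid_index_refine l0 kj e).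
Qed.

(** Whether a point stops by generation [j] depends only on its cell of generation
    [j], so the whole cell stops together with [x]. *)
Let fiberE x j m' : P x -> first_stop x = Some (j, m') ->
  P `&` first_stop @^-1` [set Some (j, m')] = cell j m' /\ (i <= j)%N.
Proof.
move=> Px /first_stopE[xm' xj xmin]; have [ij _] := asboolP _ xj.
split=> //; apply/seteqP; split=> [y [_ /first_stopE[]//]|y /= ym'].
have e : grid_index a l j x = grid_index a l j y by rewrite xm' ym'.
split; first by rewrite /P/= -(grid_index_refine l0 ij e).
apply/first_stopE; split=> // [|k yk]; first by rewrite -(stopping_cell (leqnn _) e).
rewrite leqNgt; apply/negP => kj.
by move: (yk); rewrite -(stopping_cell (ltnW kj) e) => /xmin; rewrite leqNgt kj.
Qed.

Let fiberP q : P `&` first_stop @^-1` [set Some q] = set0 \/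
  [/\ P `&` first_stop @^-1` [set Some q] = cell q.1 q.2, cell q.1 q.2 `<=` P,
    (i <= q.1)%N & exists2 x, P x & first_stop x = Some q].
Proof.
have [[x [Px xq]]|nq] := pselect (exists x, P x /\ first_stop x = Some q).
  case: q xq => j m' xq; have [e ij] := fiberE Px xq.
  by right; split=> //; [rewrite -e => y []|exists x].
by left; apply/seteqP; split=> // x [Px xq]; apply: nq; exists x.
Qed.

Lemma measurable_first_stop q : measurable (P `&` first_stop @^-1` [set q]).
Proof.
have mS r : measurable (P `&` first_stop @^-1` [set Some r]).
  by have [->//|[-> _ _ _]] := fiberP r; exact: measurable_grid_cell.
case: q => [r|]; first exact: mS.
rewrite (_ : _ `&` _ = P `\` \bigcup_r (P `&` first_stop @^-1` [set Some r])).
  by apply: measurableD => //; apply: countable_bigcupT_measurable => //.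
apply/seteqP; split=> [x [Px xN]|x [Px xN]]; split=> //.
  by move=> [r _ [_ /=]]; rewrite xN.
by move: xN; rewrite /preimage/=; case E : first_stop => [r|//] []; exists r.
Qed.

Lemma measurable_stopped : measurable (P `&` [set x | first_stop x != None]).
Proof.
rewrite (_ : _ `&` _ = P `\` (P `&` first_stop @^-1` [set None])).
  by apply: measurableD => //; exact: measurable_first_stop.
apply/seteqP; split=> [x [Px /eqP xN]|x [Px xN]]; split=> //; first by case.
by apply/eqP => e; apply: xN.
Qed.

Let g0 x : (0 <= (EFin \o g) x)%E. Proof. by rewrite lee_fin normr_ge0. Qed.

Let mg : measurable_fun setT (EFin \o g).
Proof. exact: (measurable_dist hb c). Qed.

(** The decomposition in the form used below: an inequality between integrals is
    checked outside the stopping cells and on each stopping cell [C], where the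
    mean of [b] is close to [c] because the parent of [C] did not stop. *)
Lemma le_integral_first_stop (h1 h2 : rspace R n -> \bar R) :
  (forall x, 0 <= h1 x)%E -> (forall x, 0 <= h2 x)%E ->
  measurable_fun setT h1 -> measurable_fun setT h2 ->
  (\int[mu]_(x in P `&` first_stop @^-1` [set None]) h1 x <=
   \int[mu]_(x in P `&` first_stop @^-1` [set None]) h2 x)%E ->
  (forall j m', (i <= j)%N -> let C := cell j m' in
     C `<=` P -> (forall x, C x -> first_stop x != None) ->
     ((2 * beta)%:E < avg C (EFin \o g))%E ->
     `|rmean b C - c| <= stop_const * beta ->
     (\int[mu]_(x in C) h1 x <= \int[mu]_(x in C) h2 x)%E) ->
  (\int[mu]_(x in P) h1 x <= \int[mu]_(x in P) h2 x)%E.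
Proof.
move=> h10 h20 mh1 mh2 hN hS.
apply: (@ge0_le_integral_fibers _ _ _ _ _ first_stop) => //.
  exact: measurable_first_stop.
case=> // q; have [->|[e CP ij [x Px xq]]] := fiberP q.
  by rewrite !integral_set0.
have fS y : cell q.1 q.2 y -> first_stop y != None by rewrite -e => -[_ /= ->].
rewrite e; case: q xq e CP ij fS => j m' /= xq e CP ij fS.
have [xm' xj xmin] := (first_stopE _ _ _).1 xq.
have [_] := asboolP _ xj; rewrite /above xm' => xjP.
apply: hS => //.
have {}ij : (i < j)%N.
  rewrite ltn_neqAle ij andbT; apply/eqP => eij.
  have PC : cell j m' = P.
    by rewrite /P -xm' -eij; congr (_ @^-1` [set _]); exact: Px.
  have := integral_dist_rmean hb cP; rewrite mulrC EFinM -avg_le// leNgt.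
  move: xjP; rewrite PC => xjP; rewrite (lt_trans _ xjP)// lte_fin.
  by rewrite ltr_pMl// ltr1n.
case: j xq e CP fS xm' xj xmin xjP ij => // j xq e CP fS xm' xj xmin xjP ij.
(* the parent cell [D] did not stop, which bounds the average over it *)
pose D := cell j (grid_index a l j x).
have cD : is_cube D by exact: is_cube_grid_cell.
have CD : cell j.+1 m' `<=` D.
  by move=> y /= ym'; apply/esym/(grid_index_refine l0 (leqnSn j)); rewrite xm' ym'.
have gD : (\int[mu]_(y in D) `|b y - c|%:E <= (2 * beta * vol D)%:E)%E.
  rewrite -[X in (_ <= X)%E]/(((2 * beta) * vol D)%:E) [(2 * beta * _)%R]mulrC.
  rewrite EFinM -avg_le// leNgt; apply/negP => aj.
  have /xmin : stopping x j by apply/asboolP; split.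
  by rewrite ltnn.
have cC : is_cube (cell j.+1 m') by exact: is_cube_grid_cell.
apply: (le_trans (rmean_dist hb cC cD CD gD)).
have h0 := mesh_gt0 l0 j.+1.
rewrite /vol !lebn_grid_cell// (meshS l j) exprMn.
rewrite /stop_const exprS mulrA mulfK ?expf_neq0 ?gt_eqF//.
by rewrite mulrAC.
Qed.

(** The average of [|b - c|] exceeds [2 * beta] on each stopping cell, while it is
    at most [beta] on [P]. *)
Lemma first_stop_volume :
  (mu (P `&` [set x | first_stop x != None]) <= 2^-1%:E * mu P)%E.
Proof.
set A := _ `&` _; have mA : measurable A by exact: measurable_stopped.
rewrite -(@lee_pmul2l _ (2 * beta)%:E) ?lte_fin ?mulr_gt0//.
rewrite muleA -EFinM mulrAC mulfV// mul1r.
apply: (@le_trans _ _ (\int[mu]_(x in P) (g x)%:E)%E); last first.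
  by rewrite [mu P]lebn_is_cube//; exact: integral_dist_rmean.
rewrite -[A](setIidl (_ : A `<=` P)); last by move=> x [].
rewrite -integral_indic// -ge0_integralZl_EFin//; last 2 first.
- exact/measurable_EFinP/measurable_indic.
- by rewrite mulr_ge0// ltW.
apply: le_integral_first_stop.
- by move=> x; rewrite mule_ge0// lee_fin// mulr_ge0// ltW.
- exact: g0.
- by apply: measurable_funeM; exact/measurable_EFinP/measurable_indic.
- exact: mg.
- rewrite integral0_eq; first by apply: integral_ge0 => x _; exact: g0.
  by move=> x [_ xN]; rewrite indicE memNset ?mule0// => -[_ /=]; rewrite xN.
move=> j m' ij C CP CS gC _.
have cC : is_cube C by exact: is_cube_grid_cell.
rewrite [leRHS]integral_avgE//.
apply: (@le_trans _ _ (\int[mu]_(x in C) cst (2 * beta)%:E x)%E).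
  apply: ge0_integral_mono => // x Cx; rewrite -?EFinM lee_fin.
  - by rewrite mulr_ge0// ltW.
  - by rewrite !mulr_ge0// ltW.
  - rewrite ler_piMr ?mulr_ge0 ?(ltW beta0)// indicE; by case: (_ \in _).
by rewrite integral_cst_cube// lee_pmul2l ?lte_fin ?vol_gt0// ltW.
Qed.

(** A cell that meets the unstopped part did not stop, so by Markov's inequality
    [|b - c|] is large on at most half of it; conclude by density. *)
Lemma first_stop_None : mu (P `&` first_stop @^-1` [set None] `&`
  [set x | stop_const * beta < `|b x - c|]) = 0%E.
Proof.
have mO : measurable (P `&` first_stop @^-1` [set None]).
  exact: measurable_first_stop.
have mS := measurable_dist_gt hb c (stop_const * beta).
rewrite -[X in mu X](setIidl (_ : _ `<=` P)); last by move=> x [[]].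
apply: (grid_density l0); first exact: measurableI.
move=> j m' ij C CP; have cC : is_cube C by exact: is_cube_grid_cell.
have mC : measurable C by exact: measurable_is_cube.
have [[x [Cx [_ xN]]]|nC] := pselect (exists x, C x /\ 
    (P `&` first_stop @^-1` [set None]) x); last first.
  rewrite [X in mu X](_ : _ = set0) ?measure0; first by rewrite mule_ge0.
  by apply/seteqP; split=> // x [[PN _] Cx]; apply: nC; exists x.
have nx : (avg C (EFin \o g) <= (2 * beta)%:E)%E.
  rewrite leNgt; apply/negP => ax.
  move: xN; rewrite /= /first_stop; case: pselect => // h _; apply: h.
  by exists j; apply/asboolP; split=> //; rewrite /above Cx.
rewrite -(@lee_pmul2l _ (stop_const * beta)%:E) ?lte_fin ?mulr_gt0 ?exprn_gt0//.
apply: (@le_trans _ _ (\int[mu]_(x in C) (g x)%:E)%E).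
  apply: markov_set => //.
  - exact: measurableI.
  - by rewrite ltW// mulr_gt0 ?exprn_gt0.
  - by move=> y _; exact: g0.
  - by move=> y [_ /= /ltW]; rewrite lee_fin.
rewrite [leLHS]integral_avgE// [mu C]lebn_is_cube//.
apply: (@le_trans _ _ ((vol C)%:E * (2 * beta)%:E)%E).
  by rewrite lee_pmul2l// lte_fin vol_gt0.
have := stop_const_ge4; have := vol_gt0 cC; rewrite -!EFinM lee_fin => v0 c4.
by rewrite -subr_ge0 (_ : _ - _ = (stop_const - 4) * beta * vol C / 2);
  [rewrite !mulr_ge0 ?subr_ge0 ?(ltW v0) ?(ltW beta0)// invr_ge0|field].
Qed.

End stopping.

(** * Exponential integrability and the weighted oscillation bound *)

Section john_nirenberg.
Context {R : realType} {n : nat}.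
Variables (a : rspace R n) (l : R).
Hypotheses (n_gt0 : (0 < n)%N) (l0 : 0 < l).
Notation mu := (lebn R n).
Notation cell j m := (grid_index a l j @^-1` [set m]).
Notation C0 := (@stop_const R n).

Variables (b : rspace R n -> R) (beta : R).
Hypotheses (hb : bmo_le b beta) (beta0 : 0 < beta).

Let C00 : 0 < C0. Proof. by rewrite exprn_gt0. Qed.

(** Passing from [P] to its stopping cells halves the volume and moves the mean by
    at most [C0 * beta]. *)
Lemma john_nirenberg_cell k i m :
  (mu ([set x | (k%:R * (C0 * beta) < `|b x - rmean b (cell i m)|)%R] `&`
    cell i m) <= (2^-1 ^+ k)%:E * mu (cell i m))%E.
Proof.
elim: k i m => [|k IHk] i m; set P := cell i m.
  by rewrite /= expr0 mul1e; apply: lebn_mono => x [].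
have cP : is_cube P by exact: is_cube_grid_cell.
have mP := measurable_is_cube cP.
set A := [set x | _].
have mA : measurable A by exact: measurable_dist_gt hb _ _.
pose tau := first_stop a l b beta i m.
pose S := P `&` [set x | tau x != None].
have mS : measurable S by exact: measurable_stopped.
have SP : S `<=` P by move=> x [].
rewrite -integral_indic//.
apply: (@le_trans _ _ (\int[mu]_(x in P) ((2^-1 ^+ k)%:E * (\1_S x)%:E))%E); last first.
  rewrite ge0_integralZl_EFin//; last first.
    exact/measurable_EFinP/measurable_indic.
  rewrite integral_indic// setIidl// exprSr EFinM -muleA.
  by apply: lee_wpmul2l => //; exact: first_stop_volume.
apply: (@le_integral_first_stop _ _ _ _ l0 _ _ hb beta0 i m).
- by move=> x; rewrite lee_fin.
- by move=> x; rewrite mule_ge0// lee_fin// exprn_ge0// invr_ge0.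
- exact/measurable_EFinP/measurable_indic.
- by apply: measurable_funeM; exact/measurable_EFinP/measurable_indic.
- have mO : measurable (P `&` tau @^-1` [set None]).
    exact: measurable_first_stop.
  rewrite integral_indic//.
  apply: (@le_trans _ _ 0%E).
  2: by apply: integral_ge0 => x _; rewrite mule_ge0// lee_fin// exprn_ge0// invr_ge0.
  rewrite -[leRHS](first_stop_None a n_gt0 l0 hb beta0 i m).
  apply: lebn_mono => x [Ax [Px xN]]; split=> //=; apply: le_lt_trans Ax.
  by rewrite ler_peMl ?mulr_ge0 ?(ltW C00) ?(ltW beta0)// ler1n.
move=> j m' ij C CP CS _ Cc.
have cC : is_cube C by exact: is_cube_grid_cell.
have mC := measurable_is_cube cC.
rewrite integral_indic//.
apply: (@le_trans _ _ ((2^-1 ^+ k)%:E * mu C)%E).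
  apply: le_trans (IHk j m'); apply: lebn_mono => x [Ax Cx]; split=> //=.
  have := ler_normD (b x - rmean b C) (rmean b C - rmean b P).
  rewrite addrA subrK; move: Ax; rewrite /A/= -addn1 natrD mulrDl mul1r.
  by move: Cc; rewrite -/C -/P; lra.
rewrite ge0_integralZl_EFin//; last first.
  exact/measurable_EFinP/measurable_indic.
rewrite integral_indic// [S `&` C](_ : _ = C)//.
by apply/seteqP; split=> [x []//|x Cx]; split=> //; split; [exact: CP|exact: CS].
Qed.

Variable f : rspace R n -> R.
Hypothesis mf : measurable_fun setT f.

Let F x : \bar R := `|f x|%:E.

Let F0 x : (0 <= F x)%E. Proof. by rewrite lee_fin. Qed.

Let mF : measurable_fun setT F.
Proof. by apply/measurable_EFinP; exact: measurableT_comp. Qed.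

(** A measurable minorant of the maximal function, built from countably many
    cubes. *)
Definition grid_maximal x : \bar R :=
  ereal_sup [set avg (cell j (grid_index a l j x)) F | j in [set: nat]].

Lemma avg_le_grid_maximal j m x : cell j m x -> (avg (cell j m) F <= grid_maximal x)%E.
Proof. by move=> xm; apply: ereal_sup_ubound; exists j => //; rewrite xm. Qed.

Let grid_maximal_ge0 x : (0 <= grid_maximal x)%E.
Proof.
by apply: (le_trans _ (@avg_le_grid_maximal 0 _ x erefl)); exact: avg_ge0.
Qed.

Lemma measurable_grid_maximal : measurable_fun setT grid_maximal.
Proof.
move=> mT; apply: (measurability _ (ErealGenOInfty.measurableE R)) => // _ [_ [y ->] <-].
rewrite setTI (_ : _ @^-1` _ = \bigcup_j
    (grid_index a l j @^-1` [set m | y%:E < avg (cell j m) F])%E).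
  by apply: bigcup_measurable => j _; exact: measurable_grid_preimage.
apply/seteqP; split=> [x /=|x [j _ /= yj]]; rewrite ?in_itv/= ?andbT.
  by move=> /ereal_sup_gt[_ [j _ <-] yj]; exists j.
by apply: (lt_le_trans yj); exact: avg_le_grid_maximal.
Qed.

Lemma le_grid_maximal x : (grid_maximal x <= maximal (EFin \o f) x)%E.
Proof.
apply: ge_ereal_sup => _ [j _ <-].
exact: (@le_avg_maximal _ _ _ (EFin \o f)) (is_cube_grid_cell _ l0 _ _) _.
Qed.

(** The truncation makes the induction on [k] start, at the integral of [0]. *)
Let trunc k c x : \bar R := (Num.min `|b x - c| (k%:R * (C0 * beta)) * `|f x|)%:E.

Let trunc_ge0 k c x : (0 <= trunc k c x)%E.
Proof.
by rewrite lee_fin mulr_ge0// le_min normr_ge0 !mulr_ge0// ltW.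
Qed.

Let mtrunc k c : measurable_fun setT (trunc k c).
Proof.
apply/measurable_EFinP; apply: measurable_funM; last exact: measurableT_comp.
apply: measurable_minr => //; apply/measurable_EFinP; exact: measurable_dist hb c.
Qed.

(** On the stopping cells the induction hypothesis applies after replacing the mean
    over [P] by the mean over the cell, at the cost of the integral of [|f|] over
    [P]. That integral is at most twice the integral of the maximal function over
    the unstopped part, which no later generation uses again. *)
Lemma truncated_oscillation k i m :
  (\int[mu]_(x in cell i m) trunc k (rmean b (cell i m)) x <=
   (2 * C0 * beta)%:E * \int[mu]_(x in cell i m) grid_maximal x)%E.
Proof.
have K0 : 0 <= C0 * beta by rewrite mulr_ge0// ltW.
have K20 : 0 <= 2 * C0 * beta by rewrite -mulrA mulr_ge0.
have mG := measurable_grid_maximal.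
elim: k i m => [|k IHk] i m; set P := cell i m; set c := rmean b P.
  rewrite integral0_eq; last first.
    by move=> x _; rewrite /trunc mul0r min_r// mul0r.
  by rewrite mule_ge0// integral_ge0.
have cP : is_cube P by exact: is_cube_grid_cell.
have mP := measurable_is_cube cP.
pose tau := first_stop a l b beta i m.
pose S := P `&` [set x | tau x != None].
pose O := P `&` tau @^-1` [set None].
have mS : measurable S by exact: measurable_stopped.
have mO : measurable O by exact: measurable_first_stop.
have SP : S `<=` P by move=> x [].
have PE : P = O `|` S.
  apply/seteqP; split=> [x Px|x [[]//|[]//]].
  by have [xN|xN] := eqVneq (tau x) None; [left|right].
have dOS : [disjoint O & S].
  by apply/eqP; apply/seteqP; split=> // x [[_ /= xO] [_ /=]]; rewrite xO.
pose h2 x := ((C0 * beta)%:E * F x + (2 * C0 * beta)%:E * (grid_maximal x * (\1_S x)%:E))%E.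
have p1 x : (0 <= (C0 * beta)%:E * F x)%E by rewrite mule_ge0.
have p2 x : (0 <= grid_maximal x * (\1_S x)%:E)%E by rewrite mule_ge0// lee_fin.
have p3 x : (0 <= (2 * C0 * beta)%:E * (grid_maximal x * (\1_S x)%:E))%E.
  by rewrite mule_ge0.
have p4 x : (0 <= (2 * C0 * beta)%:E * grid_maximal x)%E by rewrite mule_ge0.
have h20 x : (0 <= h2 x)%E by rewrite adde_ge0.
have mD (D : set (rspace R n)) h : measurable_fun setT h -> measurable_fun D (h : _ -> \bar R).
  exact: measurable_funTS.
have m1 D : measurable_fun D (fun x => (C0 * beta)%:E * F x)%E.
  by apply: mD; exact: measurable_funeM.
have m2 D : measurable_fun D (fun x => grid_maximal x * (\1_S x)%:E)%E.
  apply: mD; apply: emeasurable_funM => //.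
  exact/measurable_EFinP/measurable_indic.
have m3 D : measurable_fun D
    (fun x => (2 * C0 * beta)%:E * (grid_maximal x * (\1_S x)%:E))%E.
  exact: measurable_funeM.
have m4 D : measurable_fun D (fun x => (2 * C0 * beta)%:E * grid_maximal x)%E.
  by apply: mD; exact: measurable_funeM.
have m5 D : measurable_fun D grid_maximal by exact: mD.
have m6 D : measurable_fun D F by exact: mD.
have m7 k' c' D : measurable_fun D (trunc k' c') by exact: mD.
apply: (@le_trans _ _ (\int[mu]_(x in P) h2 x)%E).
  apply: (le_integral_first_stop l0 hb beta0) => //.
  - exact: emeasurable_funD.
  - pose N := [set x | C0 * beta < `|b x - c|].
    have mN : measurable N by exact: measurable_dist_gt hb _ _.
    have mON : measurable (O `&` N) by exact: measurableI.
    have ON0 : mu (O `&` N) = 0%E by exact: first_stop_None.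
    rewrite (@ge0_negligible_integral _ _ _ mu O (O `&` N))//.
    apply: ge0_integral_mono => // x [Ox NNx].
    rewrite /h2; apply: (@le_trans _ _ ((C0 * beta)%:E * F x)%E).
      rewrite /F -EFinM lee_fin ler_wpM2r// ge_min; apply/orP; left.
      by rewrite leNgt; apply/negP => Nx; apply: NNx.
    by rewrite leeDl// !mule_ge0// lee_fin.
  - move=> j m' ij C CP CS _ Cc.
    have cC : is_cube C by exact: is_cube_grid_cell.
    have mC := measurable_is_cube cC.
    apply: (@le_trans _ _ (\int[mu]_(x in C) ((C0 * beta)%:E * F x + trunc k (rmean b C) x))%E).
      apply: ge0_integral_mono => // x Cx; first by rewrite adde_ge0// mule_ge0.
      rewrite /trunc /F -EFinM -EFinD lee_fin -mulrDl ler_wpM2r//.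
      have := ler_normD (b x - rmean b C) (rmean b C - c); rewrite addrA subrK.
      rewrite -addn1 natrD mulrDl mul1r; move: Cc; rewrite -/C -/P -/c.
      by rewrite addr_minr le_min !ge_min => ? ?; apply/andP; split; apply/orP; [left|right]; lra.
    rewrite ge0_integralD//.
    apply: (@le_trans _ _ (\int[mu]_(x in C) ((C0 * beta)%:E * F x) +
       (2 * C0 * beta)%:E * \int[mu]_(x in C) grid_maximal x)%E).
      by rewrite leeD2l//; exact: IHk.
    rewrite -ge0_integralZl_EFin// -ge0_integralD//.
    apply: ge0_integral_mono => // x Cx.
      by rewrite adde_ge0// mule_ge0.
    rewrite /h2 indicE mem_set ?mule1//; split; [exact: CP|exact: CS].
rewrite ge0_integralD// !ge0_integralZl_EFin//.
have half : (\int[mu]_(x in P) F x <= 2%:E * \int[mu]_(x in O) grid_maximal x)%E.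
  apply: (@le_trans _ _ (2%:E * \int[mu]_(x in O) cst (avg P F) x)%E); last first.
    rewrite lee_wpmul2l//; apply: ge0_integral_mono => // x [Px _]; first exact: avg_ge0.
    exact: avg_le_grid_maximal.
  rewrite integral_avgE// integral_cst// [leLHS]muleC [leRHS]muleCA.
    apply: lee_wpmul2l; first exact: avg_ge0.
  have Poo : mu P = (vol P)%:E by exact: lebn_is_cube.
  have fin D : D `<=` P -> mu D \is a fin_num.
    by move=> DP; rewrite ge0_fin_numE// (le_lt_trans (lebn_mono DP))// Poo ltry.
  have := first_stop_volume a l0 hb beta0 i m; rewrite -/P -/tau -/S.
  have : mu P = (mu O + mu S)%E by rewrite -measureU// -?PE//; exact/eqP.
  rewrite Poo -(fineK (fin _ SP)) -(fineK (fin O _)); last by move=> x [].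
  rewrite -EFinD => -[e1]; rewrite -!EFinM !lee_fin.
  move=> e2; rewrite [leRHS](_ : _ = 2%:E * (fine (mu O))%:E)%E; last first.
    by congr (_ * _)%E; rewrite fineK// fin// => x [].
  suff key (v o s : R) : v = o + s -> s <= 2^-1 * v -> v <= 2 * o by rewrite -EFinM lee_fin; exact: key e1 e2.
  lra.
have e : (\int[mu]_(x in P) grid_maximal x = \int[mu]_(x in O) grid_maximal x +
    \int[mu]_(x in P) (grid_maximal x * (\1_S x)%:E))%E.
  have -> : (\int[mu]_(x in P) (grid_maximal x * (\1_S x)%:E) =
      \int[mu]_(x in S) grid_maximal x)%E.
    rewrite [in RHS]integral_mkcond [in LHS]integral_mkcond.
    apply: eq_integral => x _; rewrite !patchE indicE.
    case: (boolP (x \in S)) => [xS|xS]; last by rewrite mule0 if_same.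
    by rewrite mule1 mem_set//; apply: SP; exact: set_mem.
  by rewrite [in LHS]PE ge0_integral_setU.
rewrite e [leRHS]ge0_muleDr ?integral_ge0//.
apply: leeD => //; apply: (@le_trans _ _ ((C0 * beta)%:E * (2%:E * \int[mu]_(x in O) grid_maximal x))%E).
  by rewrite lee_wpmul2l.
by rewrite muleA -EFinM mulrC mulrA.
Qed.

Lemma weighted_oscillation_cell i m :
  (\int[mu]_(x in cell i m) (`|b x - rmean b (cell i m)| * `|f x|)%:E <=
   (2 * C0 * beta)%:E * \int[mu]_(x in cell i m) grid_maximal x)%E.
Proof.
set P := cell i m; set c := rmean b P.
have K0 : 0 < C0 * beta by rewrite mulr_gt0.
have mP : measurable P by exact: measurable_grid_cell.
have truncE x : (fun k => trunc k c x) @ \oo --> (`|b x - c| * `|f x|)%:E.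
  apply: cvg_near_cst; near=> k; rewrite /trunc min_l//.
  rewrite -ler_pdivrMr//; near: k; exact: nbhs_infty_ger.
have ndt x : {homo (fun k => trunc k c x) : k1 k2 / (k1 <= k2)%N >-> (k1 <= k2)%E}.
  move=> k1 k2 k12; rewrite lee_fin ler_wpM2r// le_min !ge_min lexx/=.
  by rewrite ler_wpM2r ?(ltW K0) ?ler_nat// orbT.
have mt k : measurable_fun P (trunc k c) by exact: measurable_funTS.
rewrite (_ : (\int[mu]_(x in P) _)%E =
    (\int[mu]_(x in P) limn (fun k => trunc k c x))%E); last first.
  by apply: eq_integral => x _; rewrite (cvg_lim _ (truncE x)).
rewrite monotone_convergence//; apply: lime_le.
  apply: ereal_nondecreasing_is_cvgn => k1 k2 k12.
  by apply: ge0_integral_mono => // x _; exact: ndt.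
by near=> k; exact: truncated_oscillation.
Unshelve. all: by end_near. Qed.

End john_nirenberg.

Section cubes.
Context {R : realType} {n : nat}.
Hypothesis n_gt0 : (0 < n)%N.
Notation mu := (lebn R n).
Notation C0 := (@stop_const R n).
Variables (b : rspace R n -> R) (beta : R).
Hypotheses (hb : bmo_le b beta) (beta0 : 0 < beta).

Lemma cube_grid_cell (a : rspace R n) l : 0 < l ->
  cube a l = grid_index a l 0 @^-1` [set [ffun=> 0]].
Proof.
move=> l0; rewrite grid_cellE//; congr cube; last by rewrite /mesh expr0 divr1.
by apply: eq_from_tnth => i; rewrite tnth_mktuple ffunE mul0r addr0.
Qed.

Lemma john_nirenberg P (s : R) : is_cube P ->
  (mu ([set x | (s * beta < `|b x - rmean b P|)%R] `&` P) <=
   (2 * expR (- (ln 2 / C0 * s)))%:E * mu P)%E.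
Proof.
move=> cP; have C00 : 0 < C0 by rewrite exprn_gt0.
have l20 : 0 < ln (2 : R) by rewrite ln_gt0// ltr1n.
have [s0|s0] := ltP s 0.
  apply: (@le_trans _ _ (mu P)); first by apply: lebn_mono => x [].
  rewrite [leLHS]lebn_is_cube// [mu P]lebn_is_cube// -EFinM lee_fin.
  rewrite ler_peMl ?(ltW (vol_gt0 cP))//.
  have : 0 <= - (ln 2 / C0 * s).
    by rewrite oppr_ge0 mulr_ge0_le0 ?divr_ge0 ?(ltW C00) ?(ltW l20) ?(ltW s0).
  by have := expR_ge1Dx (- (ln 2 / C0 * s)); lra.
pose k := Num.truncn (s / C0).
have [a [l [l0 ->]]] := cP; rewrite (cube_grid_cell a l0).
apply: (@le_trans _ _ ((2^-1 ^+ k)%:E * mu (grid_index a l 0 @^-1` [set [ffun=> 0%R]]))%E).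
  apply: le_trans (john_nirenberg_cell a n_gt0 l0 hb beta0 k _ _).
  apply: lebn_mono => x [sx Px]; split=> //=; apply: le_lt_trans sx.
  rewrite mulrA ler_wpM2r ?(ltW beta0)// -ler_pdivlMr//.
  by rewrite truncn_le divr_ge0// ltW.
apply: lee_wpmul2r; first exact: measure_ge0.
rewrite lee_fin -[X in X ^+ k](@lnK _ 2^-1) ?posrE// lnV ?posrE//.
rewrite -expRM_natl -[X in X * expR _](@lnK _ 2) ?posrE// -expRD ler_expR.
have := truncnS_gt (s / C0); rewrite -/k -natr1 => ks.
suff : ln 2 * (s / C0) <= ln 2 * (k%:R + 1) :> R.
  by rewrite [ln 2 / C0 * s]mulrAC -[ln 2 * s / C0]mulrA; lra.
by rewrite ler_wpM2l// ltW.
Qed.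

Variable f : rspace R n -> R.
Hypothesis mf : measurable_fun setT f.

(** This plays the role of the duality between exp L and L log L, together with
    the control of L log L averages by iterated maximal functions. *)
Lemma weighted_oscillation P x : is_cube P -> P x ->
  (avg P (fun y => osc b P y * `|f y|%:E) <=
   (2 * C0 * beta)%:E * maximal (maximal (EFin \o f)) x)%E.
Proof.
move=> cP Px; rewrite avg_le//.
have [a [l [l0 Pal]]] := cP.
have PE : P = grid_index a l 0 @^-1` [set [ffun=> 0]] by rewrite Pal cube_grid_cell.
rewrite (_ : (\int[mu]_(y in P) _)%E =
    (\int[mu]_(y in P) (`|b y - rmean b P| * `|f y|)%:E)%E); last first.
  by apply: eq_integral => y _; rewrite (oscE hb).
have K0 : 0 <= 2 * C0 * beta by rewrite !mulr_ge0 ?exprn_ge0// ltW.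
rewrite [in leLHS]PE; apply: (le_trans (weighted_oscillation_cell a n_gt0 l0 hb beta0 mf _ _)).
rewrite -PE muleCA; apply: lee_wpmul2l => //.
apply: (@le_trans _ _ (\int[mu]_(y in P) maximal (EFin \o f) y)%E).
  apply: ge0_integral_mono => // y _; rewrite ?maximal_ge0//; last exact: le_grid_maximal.
  by apply: (le_trans _ (@avg_le_grid_maximal _ _ a l f 0 _ y erefl)); exact: avg_ge0.
rewrite -avg_le//; apply: (le_trans _ (le_avg_maximal _ cP Px)).
by apply: le_avg => y _; rewrite /= ?gee0_abs ?maximal_ge0.
Qed.

End cubes.

(** * Counting the cubes of a sparse family *)

Section cube_geometry.
Context {R : realType} {n : nat}.
Hypothesis n_gt0 : (0 < n)%N.
Notation mu := (lebn R n).

(** A dilate of [cube a l] large enough to contain every cube of side at most [c]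
    that meets it. *)
Definition grow (a : rspace R n) (l c : R) : set (rspace R n) :=
  cube [tuple tnth a i - c | i < n] (l + 2 * c).

Lemma is_cube_grow a l c : 0 < l -> 0 <= c -> is_cube (grow a l c).
Proof. by move=> l0 c0; do 2 eexists; split; last reflexivity; lra. Qed.

Lemma sub_grow a l c a' l' : l' <= c -> cube a' l' `&` cube a l !=set0 ->
  cube a' l' `<=` grow a l c.
Proof.
move=> lc [y [ya' ya]] x xa' i; rewrite tnth_mktuple.
have /andP[? ?] := ya' i; have /andP[? ?] := ya i; have /andP[? ?] := xa' i.
by apply/andP; split; lra.
Qed.

Lemma grow_sub_grow a l c c' : c <= c' -> grow a l c `<=` grow a l c'.
Proof.
move=> cc x xc i; have := xc i; rewrite !tnth_mktuple => /andP[? ?].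
by apply/andP; split; lra.
Qed.

Lemma sub_grow_self a l c : 0 <= c -> cube a l `<=` grow a l c.
Proof.
move=> c0 x xa i; have := xa i; rewrite tnth_mktuple => /andP[? ?].
by apply/andP; split; lra.
Qed.

Lemma vol_cube (a : rspace R n) l : 0 <= l -> vol (cube a l) = l ^+ n.
Proof. by move=> l0; rewrite /vol lebn_cube. Qed.

Lemma vol_grow a l c : 0 <= l -> 0 <= c -> vol (grow a l c) = (l + 2 * c) ^+ n.
Proof. by move=> l0 c0; rewrite vol_cube//; lra. Qed.

Lemma le_vol_cube (a a' : rspace R n) l l' : 0 < l -> 0 < l' ->
  (vol (cube a l) <= vol (cube a' l')) = (l <= l').
Proof. by move=> l0 l0'; rewrite !vol_cube ?(ltW l0) ?(ltW l0')// ler_pXn2r// nnegrE ltW. Qed.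

(** How sparseness is used: volumes are paid for by disjoint sets. *)
Lemma sum_disjoint_le (s : seq (set (rspace R n))) (k : R)
    (E : set (rspace R n) -> set (rspace R n)) (W : set (rspace R n)) :
  uniq s -> trivIset [set` s] E -> measurable W ->
  (forall P, P \in s -> measurable (E P) /\ E P `<=` W) ->
  (forall P, P \in s -> (k * vol P)%:E <= mu (E P))%E ->
  ((k * \sum_(P <- s) vol P)%:E <= mu W)%E.
Proof.
move=> us tE mW hE kE; rewrite mulr_sumr -sumEFin.
apply: (@le_trans _ _ (\sum_(P <- s) mu (E P))%E).
  by rewrite big_seq [leRHS]big_seq; apply: lee_sum.
rewrite fsbig_seq// -measure_fin_bigcup//; last by move=> P /hE[].
by apply: lebn_mono => x [P /hE[_ EW] /EW].
Qed.

End cube_geometry.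

Section sparse_counting.
Context {R : realType} {n : nat}.
Hypothesis n_gt0 : (0 < n)%N.
Notation mu := (lebn R n).
Variables (eta : R) (S : set (set (rspace R n))).
Hypotheses (eta0 : 0 < eta) (Scube : S `<=` is_cube) (Ssp : sparse eta S).

Definition meets (P W : set (rspace R n)) : bool := `[< P `&` W !=set0 >].

(** The Carleson packing condition: cubes no larger than [P] that meet [P] lie in
    its threefold dilate, and so do the disjoint sets attached to them. *)
Lemma sparse_packing s P : uniq s -> is_cube P ->
  (forall P', P' \in s -> [/\ S P', meets P' P & vol P' <= vol P]) ->
  \sum_(P' <- s) vol P' <= 3 ^+ n / eta * vol P.
Proof.
move=> us [a [l [l0 ->]]] hs; have [E [hE tE]] := Ssp.
have cW : is_cube (grow a l l) by apply: is_cube_grow => //; exact: ltW.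
rewrite mulrAC ler_pdivlMr// mulrC -lee_fin.
rewrite (_ : (3 ^+ n * _)%:E = mu (grow a l l)); last first.
  rewrite [RHS]lebn_is_cube// vol_grow ?vol_cube ?ltW// -exprMn.
  by congr (_ ^+ _)%:E; lra.
apply: (sum_disjoint_le (E := E)) => //.
- by apply: sub_trivIset tE => P' /= /hs[].
- exact: measurable_is_cube.
- move=> P' P's; have [SP' /asboolP mP' vP'] := hs _ P's.
  have [mE EP' _] := hE _ SP'; split=> // x /EP'.
  have [a' [l' [l0' P'E]]] := Scube SP'; move: mP' vP'; rewrite P'E => mP'.
  rewrite le_vol_cube// => ll'; exact: sub_grow.
- move=> P' P's; have [SP' _ _] := hs _ P's; have [_ _] := hE _ SP'.
  by rewrite [mu P']lebn_is_cube//; exact: Scube.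
Qed.

Definition overlap (s : seq (set (rspace R n))) (x : rspace R n) : R :=
  \sum_(P <- s) \1_P x.

(** The base of the exponential, so close to [1] that [packing_growth] holds. *)
Definition growth : R := 1 + eta / (2 * 3 ^+ n).

Let growth_gt1 : 1 < growth.
Proof. by rewrite ltrDl divr_gt0// mulr_gt0// exprn_gt0. Qed.

Definition growth_rate : R := ln growth.

Lemma growth_rate_gt0 : 0 < growth_rate.
Proof. exact: ln_gt0. Qed.

Lemma measurable_overlap s : all (fun P => `[< measurable P >]) s ->
  measurable_fun setT (overlap s).
Proof.
elim: s => [_|P s IHs /andP[/asboolP mP /IHs ms]].
  rewrite (_ : overlap _ = cst 0); first exact: measurable_cst.
  by apply/funext => x; rewrite /overlap big_nil.
rewrite (_ : overlap _ = fun x => \1_P x + overlap s x).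
  by apply: measurable_funD => //; exact: measurable_indic.
by apply/funext => x; rewrite /overlap big_cons.
Qed.

Let expg s x := expR (growth_rate * overlap s x).

Let expg_cons P s x :
  expg (P :: s) x = expg s x + (growth - 1) * (\1_P x * expg s x).
Proof.
rewrite /expg /overlap big_cons mulrDr expRD.
suff -> : expR (growth_rate * \1_P x) = 1 + (growth - 1) * \1_P x by ring.
rewrite indicE; case: (x \in P); last by rewrite !mulr0 expR0 addr0.
rewrite !mulr1 /growth_rate lnK ?posrE ?(lt_trans _ growth_gt1)//; lra.
Qed.

Let packing_growth s P : uniq s -> is_cube P ->
  (forall P', P' \in s -> [/\ S P', meets P' P & vol P' <= vol P]) ->
  2 * (growth - 1) * \sum_(P' <- s) vol P' <= vol P.
Proof.
move=> us cP hs.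
have e3 : (3 : R) ^+ n != 0 by rewrite expf_neq0.
have k0 : 0 <= 2 * (growth - 1) by rewrite mulr_ge0// subr_ge0 ltW.
apply: (le_trans (ler_wpM2l k0 (sparse_packing us cP hs))).
rewrite le_eqVlt; apply/orP; left; apply/eqP; rewrite /growth.
by field; rewrite e3 gt_eqF.
Qed.

(** Adding the cubes from the smallest to the largest, each new cube [P] adds to
    the integral over [W] a multiple of the integral over [P] of the exponential
    attached to the smaller cubes, which packing keeps below [2 * vol P]. *)
Lemma integral_exp_overlap s (W : set (rspace R n)) : measurable W -> uniq s ->
  sorted (fun P P' => vol P' <= vol P) s -> (forall P, P \in s -> S P) ->
  (\int[mu]_(x in W) (expg s x)%:E <= mu W +
    (2 * (growth - 1) * \sum_(P <- s | meets P W) vol P)%:E)%E.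
Proof.
elim: s W => [|P s IHs] W mW.
  move=> _ _ _; rewrite big_nil mulr0 adde0.
  rewrite -[leRHS]mul1e -integral_cst//; apply: ge0_integral_mono => // x _.
    by rewrite lee_fin expR_ge0.
  by rewrite /expg /overlap big_nil mulr0 expR0.
move=> /andP[Ps us] so sS.
have so' : sorted (fun P P' => vol P' <= vol P) s := path_sorted so.
have sS' P' : P' \in s -> S P' by move=> P's; apply: sS; rewrite inE P's orbT.
have SP : S P by apply: sS; rewrite inE eqxx.
have cP := Scube SP; have mP := measurable_is_cube cP.
have vP P' : P' \in s -> vol P' <= vol P.
  have tr : transitive (fun P P' : set (rspace R n) => vol P' <= vol P).
    by move=> y x z xy yz; exact: le_trans yz xy.
  by move=> P's; have /allP := order_path_min tr so; exact.
have g0 : 0 < growth - 1 by rewrite subr_gt0.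
have e0 x : (0 <= (expg s x)%:E)%E by rewrite lee_fin expR_ge0.
have me : measurable_fun setT (EFin \o expg s).
  apply/measurable_EFinP; apply: measurableT_comp => //.
  apply: measurable_funM => //; apply: measurable_overlap.
  by apply/allP => P' /sS'/Scube/measurable_is_cube mP'; exact/asboolP.
have meD D : measurable_fun D (fun x => (expg s x)%:E) by exact: measurable_funTS.
have mi : measurable_fun W (fun x => (\1_P x * expg s x)%:E).
  rewrite (_ : (fun x => _) = (fun x => (\1_P x)%:E * (expg s x)%:E)%E)//.
  apply: emeasurable_funM => //.
  apply: measurable_funTS; exact/measurable_EFinP/measurable_indic.
have i0 x : (0 <= (\1_P x * expg s x)%:E)%E by rewrite lee_fin mulr_ge0// expR_ge0.
rewrite (_ : (\int[mu]_(x in W) _)%E = (\int[mu]_(x in W)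
    ((expg s x)%:E + (growth - 1)%:E * (\1_P x * expg s x)%:E))%E); last first.
  by apply: eq_integral => x _; rewrite expg_cons EFinD EFinM.
rewrite ge0_integralD//; last 2 first.
- by move=> x _; rewrite mule_ge0// lee_fin ltW.
- exact: measurable_funeM.
rewrite ge0_integralZl_EFin//; last exact: ltW.
rewrite big_cons.
have IHW := IHs W mW us so' sS'.
have [mPW|mPW] := boolP (meets P W); last first.
  rewrite (_ : (\int[mu]_(x in W) (\1_P x * expg s x)%:E)%E = 0%E).
    by rewrite mule0 adde0.
  apply: integral0_eq => x Wx; rewrite indicE memNset ?mul0r// => Px.
  by move/negP : mPW; apply; apply/asboolP; exists x.
have pk : 2 * (growth - 1) * \sum_(P' <- s | meets P' P) vol P' <= vol P.
  rewrite -big_filter; apply: packing_growth => //; first exact: filter_uniq.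
  by move=> P'; rewrite mem_filter => /andP[mP' P's]; split; [exact: sS'| |exact: vP].
have iP : (\int[mu]_(x in W) (\1_P x * expg s x)%:E <= (2 * vol P)%:E)%E.
  rewrite (_ : (\int[mu]_(x in W) _)%E =
      (\int[mu]_(x in W `&` P) (expg s x)%:E)%E); last first.
    rewrite [RHS]integral_mkcondr; apply: eq_integral => x _.
    by rewrite patchE indicE; case: ifP => _; rewrite ?mul1r ?mul0r.
  apply: (@le_trans _ _ (\int[mu]_(x in P) (expg s x)%:E)%E).
    by apply: ge0_integral_mono => // x [].
  apply: (le_trans (IHs P mP us so' sS')).
  by rewrite [mu P]lebn_is_cube// -EFinD lee_fin; lra.
apply: (@le_trans _ _ ((mu W + (2 * (growth - 1) *
    \sum_(P' <- s | meets P' W) vol P')%:E) + (growth - 1)%:E * (2 * vol P)%:E)%E).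
  by apply: leeD => //; apply: lee_wpmul2l => //; rewrite lee_fin ltW.
by rewrite -addeA leeD2l// -EFinM -EFinD lee_fin; lra.
Qed.

Lemma perm_overlap s1 s2 : perm_eq s1 s2 -> overlap s1 = overlap s2.
Proof. by move=> s12; apply/funext => x; exact: perm_big. Qed.

Variable Q : set (rspace R n).
Hypothesis cQ : is_cube Q.

Definition small_cubes : set (set (rspace R n)) :=
  [set P | [/\ S P, meets P Q & vol P < vol Q]].

(** Markov's inequality for the exponential, after sorting by volume. *)
Lemma overlap_decay_fin s y : uniq s -> (forall P, P \in s -> small_cubes P) ->
  (mu ([set x | (y < overlap s x)%R] `&` Q) <=
    (2 * expR (- (growth_rate * y)))%:E * mu Q)%E.
Proof.
move=> us hs.
pose leT (P P' : set (rspace R n)) := vol P' <= vol P.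
have tot : total leT by move=> P P'; rewrite /leT le_total.
have ps := permEl (perm_sort leT s).
rewrite -(perm_overlap ps); set s' := sort leT s in ps *.
have us' : uniq s' by rewrite sort_uniq.
have hs' P : P \in s' -> small_cubes P by rewrite mem_sort; exact: hs.
have mQ := measurable_is_cube cQ.
have mo : measurable_fun setT (overlap s').
  apply: measurable_overlap; apply/allP => P /hs'[/Scube/measurable_is_cube ? _ _].
  exact/asboolP.
pose A := [set x | y < overlap s' x].
have mA : measurable A.
  rewrite (_ : A = overlap s' @^-1` `]y, +oo[); last first.
    by apply/seteqP; split=> x /=; rewrite in_itv/= andbT.
  by rewrite -[X in measurable X]setTI; exact: mo.
rewrite -(@lee_pmul2l _ (expR (growth_rate * y))%:E) ?lte_fin ?expR_gt0//.
rewrite muleA -EFinM mulrCA -expRD subrr expR0 mulr1.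
apply: (@le_trans _ _ (\int[mu]_(x in Q) (expg s' x)%:E)%E).
  apply: markov_set => //.
  - by move=> x _; rewrite lee_fin expR_ge0.
  - move=> x Ax _; rewrite lee_fin ler_expR.
    by rewrite ler_wpM2l ?ltW// growth_rate_gt0.
apply: (le_trans (integral_exp_overlap mQ us' (sort_sorted tot s) _)).
  by move=> P /hs'[].
rewrite [mu Q]lebn_is_cube// -EFinD -EFinM lee_fin.
rewrite (_ : \sum_(P <- s' | _) _ = \sum_(P <- s') vol P).
  suff : 2 * (growth - 1) * \sum_(P <- s') vol P <= vol Q by lra.
  by apply: packing_growth => // P /hs'[? ? /ltW].
rewrite big_seq_cond [RHS]big_seq; apply: eq_bigl => P.
by case: (boolP (P \in s')) => // /hs'[_ -> _].
Qed.

Let small_packing s : uniq s -> (forall P, P \in s -> small_cubes P) ->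
  \sum_(P <- s) vol P <= 3 ^+ n / eta * vol Q.
Proof.
by move=> us hs; apply: sparse_packing => // P /hs[SP mP /ltW].
Qed.

(** By packing, only finitely many small cubes have volume above a given bound. *)
Lemma countable_small_cubes : countable small_cubes.
Proof.
have -> : small_cubes =
    \bigcup_(k in [set: nat]) (small_cubes `&` [set P | k.+1%:R^-1 < vol P]).
  apply/seteqP; split=> [P sP|P [k _ []//]].
  have vP : 0 < vol P by apply: vol_gt0; apply: Scube; case: sP.
  exists (Num.truncn (vol P)^-1) => //; split=> //=.
  by rewrite invf_plt ?posrE// truncnS_gt.
apply: bigcup_countable => [|k _]; first exact: countableP.
apply: finite_set_countable; apply: contrapT => infk.
pose m := Num.truncn (k.+1%:R * (3 ^+ n / eta * vol Q)).
have [B hB mB] := infinite_set_fset m.+1 infk.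
pose s := finmap.enum_fset B; have us : uniq s by exact: finmap.fset_uniq.
have hs P : P \in s -> small_cubes P /\ k.+1%:R^-1 < vol P by move=> /hB.
have : \sum_(P <- s) vol P <= 3 ^+ n / eta * vol Q.
  by apply: small_packing => // P /hs[].
have : \sum_(P <- s) k.+1%:R^-1 <= \sum_(P <- s) vol P.
  by rewrite big_seq [leRHS]big_seq; apply: ler_sum => P /hs[_ /ltW].
rewrite big_const_seq count_predT iter_addr_0 => h1 h2.
have {h1 h2} := le_trans h1 h2; rewrite -[_^-1 *+ _]mulr_natl ler_pdivrMr// mulrC.
apply/negP; rewrite -ltNge (lt_le_trans (truncnS_gt _))// ler_nat; exact: mB.
Qed.

(** The exceptional set is an increasing union over finite subfamilies that exhaust
    the countable family. It is bounded by a measurable [B] so that several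
    exceptional sets can be added up. *)
Lemma overlap_limit (A : set (set (rspace R n))) y (K : \bar R) :
  countable A -> A `<=` is_cube ->
  (forall s, uniq s -> (forall P, P \in s -> A P) ->
    mu ([set x | (y < overlap s x)%R] `&` Q) <= K)%E ->
  exists B, [/\ measurable B, (mu B <= K)%E &
    forall x s, Q x -> uniq s -> (forall P, P \in s -> A P) ->
      y < overlap s x -> B x].
Proof.
move=> /countable_injP[iota iotaI] cA hK.
pose D k := A `&` [set P | (iota P < k)%N].
have finD k : finite_set (D k).
  rewrite -(eq_finite_set (inj_card_eq (f := iota) _)).
    by apply: (sub_finite_set (B := `I_k)) => // _ [P [_ /= Pk] <-].
  move=> P1 P2 /set_mem[sP1 _] /set_mem[sP2 _].
  by apply: iotaI; exact: mem_set.
pose l k : seq (set (rspace R n)) := finmap.enum_fset (fset_set (D k)).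
have ul k : uniq (l k) by exact: finmap.fset_uniq.
have lE k P : (P \in l k) = (P \in D k) by exact: in_fset_set.
have lA k P : P \in l k -> A P by rewrite lE => /set_mem[].
have le_overlap s k x : uniq s -> {subset s <= l k} -> overlap s x <= overlap (l k) x.
  move=> us sk; have /perm_overlap -> : perm_eq (l k) (s ++ [seq P <- l k | P \notin s]).
    apply: uniq_perm => // [|P].
      rewrite cat_uniq us filter_uniq// andbT; apply/hasPn => P.
      by rewrite mem_filter => /andP[].
    rewrite mem_cat mem_filter; case: (boolP (P \in s)) => //= Ps.
    by rewrite sk.
  by rewrite /overlap big_cat lerDl sumr_ge0// => P _; rewrite indicE.
pose U k := [set x | (y < overlap (l k) x)%R] `&` Q.
have mU k : measurable (U k).
  apply: measurableI; last exact: measurable_is_cube.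
  have mo : measurable_fun setT (overlap (l k)).
    apply: measurable_overlap; apply/allP => P /lA/cA/measurable_is_cube ?.
    exact/asboolP.
  rewrite (_ : mkset _ = overlap (l k) @^-1` `]y, +oo[); last first.
    by apply/seteqP; split=> x /=; rewrite in_itv/= andbT.
  by rewrite -[X in measurable X]setTI; exact: mo.
exists (\bigcup_k U k); split; first exact: bigcup_measurable.
- have cvgU : mu \o U @ \oo --> mu (\bigcup_k U k).
    apply: nondecreasing_cvg_mu => //; first exact: bigcup_measurable.
    move=> k1 k2 k12; apply/subsetPset => x [yx Qx]; split=> //=.
    apply: (lt_le_trans yx); apply: le_overlap => // P; rewrite !lE => /set_mem[? ?].
    by apply/mem_set; split=> //=; exact: leq_trans k12.
  rewrite -(cvg_lim _ cvgU)//; apply: lime_le.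
    by apply/cvg_ex; eexists; exact: cvgU.
  by apply: nearW => k; apply: hK => //; exact: lA.
- move=> x s Qx us hs ys.
  exists (\max_(P <- s) iota P).+1 => //; split=> //=; apply: (lt_le_trans ys).
  apply: le_overlap => // P Ps; rewrite lE; apply/mem_set; split; first exact: hs.
  by rewrite /= ltnS; apply: leq_bigmax_seq.
Qed.

Lemma overlap_decay y : exists B, [/\ measurable B,
  (mu B <= (2 * expR (- (growth_rate * y)))%:E * mu Q)%E &
  forall x s, Q x -> uniq s -> (forall P, P \in s -> small_cubes P) ->
    y < overlap s x -> B x].
Proof.
apply: overlap_limit; first exact: countable_small_cubes.
  by move=> P [/Scube].
by move=> s; exact: overlap_decay_fin.
Qed.

End sparse_counting.

(** * Large cubes of a dyadic lattice *)

Section large_cubes.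
Context {R : realType} {n : nat}.
Hypothesis n_gt0 : (0 < n)%N.
Notation mu := (lebn R n).
Implicit Types P Q : set (rspace R n).

Lemma cube_inj (a a' : rspace R n) l l' : 0 < l -> 0 < l' ->
  cube a l = cube a' l' -> a = a' /\ l = l'.
Proof.
move=> l0 l0' e.
have ll' : l = l'.
  have := le_vol_cube n_gt0 a a' l0 l0'; have := le_vol_cube n_gt0 a' a l0' l0.
  by rewrite e lexx => /esym h1 /esym h2; apply/eqP; rewrite eq_le h1 h2.
have aa : cube a' l' a by rewrite -e => i; rewrite lexx ltrDl.
have aa' : cube a l a' by rewrite e => i; rewrite lexx ltrDl.
split=> //; apply: eq_from_tnth => i; apply/eqP; rewrite eq_le.
by have /andP[-> _] := aa i; have /andP[-> _] := aa' i.
Qed.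

Lemma dyadic_grid_cell (a : rspace R n) l P : 0 < l -> dyadic_grid (cube a l) P ->
  exists k m, P = grid_index a l k @^-1` [set m].
Proof.
move=> l0; elim=> [|_ _ _ [k [m ->]] [a1 [l1 [e [l10 e1 ->]]]]].
  by exists 0%N, [ffun=> 0]; exact: cube_grid_cell.
move: e1; rewrite grid_cellE// => /cube_inj => /(_ (mesh_gt0 l0 k) l10) [ea el].
exists k.+1, [ffun i => m i * 2 + (e i)%:Z]; rewrite grid_cellE//.
have hm : l1 / 2 = mesh l k.+1 by rewrite -el (meshS l k); field.
rewrite hm -ea; congr cube; apply: eq_from_tnth => i; rewrite !tnth_mktuple ffunE.
by rewrite (meshS l k) intrD intrM; ring.
Qed.

(** The volume of [P] relative to [Q] determines [j]; volumes replace side lengths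
    so that no choice of a corner and a side is involved. *)
Definition gap Q j P : Prop :=
  (2 ^+ n) ^+ j * vol Q <= vol P < (2 ^+ n) ^+ j.+1 * vol Q.

Lemma exists_gap P Q : is_cube P -> is_cube Q -> vol Q <= vol P ->
  exists j, gap Q j P.
Proof.
move=> cP cQ QP; have vQ := vol_gt0 cQ.
have ex : exists j, vol P < (2 ^+ n) ^+ j.+1 * vol Q.
  exists (Num.truncn (vol P / vol Q)); rewrite -ltr_pdivrMr//.
  apply: (lt_le_trans (truncnS_gt _)).
  rewrite -exprM -natrX ler_nat (leq_trans _ (leq_pexp2l _ (leq_pmull _ n_gt0)))//.
  exact/ltnW/ltn_expl.
case: (ex_minnP ex) => j Pj jmin; exists j; rewrite /gap Pj andbT.
case: j Pj jmin => [|j] _ jmin; first by rewrite expr0 mul1r.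
by rewrite leNgt; apply/negP => /jmin; rewrite ltnn.
Qed.

(** Both cubes are cells of one grid. Cells of different generations differ in
    volume by a factor at least [2 ^ n], and cells of one generation are equal or
    disjoint. *)
Lemma dyadic_gap_inj (D : set (set (rspace R n))) Q j P1 P2 x :
  dyadic_lattice D -> is_cube Q -> D P1 -> D P2 -> P1 x -> P2 x ->
  gap Q j P1 -> gap Q j P2 -> P1 = P2.
Proof.
move=> [Dc _ Du _] cQ D1 D2 x1 x2 g1 g2.
have [P [DP]] := Du _ _ D1 D2; have [a [l [l0 ->]]] := Dc _ DP.
move=> /(dyadic_grid_cell l0)[k1 [m1 E1]] /(dyadic_grid_cell l0)[k2 [m2 E2]].
suff k12 : k1 = k2.
  by move: x1 x2; rewrite E1 E2 k12 /= => <- <-.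
have low i k m m' : (i < k)%N ->
    gap Q j (grid_index a l i @^-1` [set m]) ->
    gap Q j (grid_index a l k @^-1` [set m']) -> False.
  move=> ik /andP[_ h1] /andP[h2 _]; move: h1; apply/negP; rewrite -leNgt.
  rewrite exprS -mulrA; apply: (@le_trans _ _ (2 ^+ n * vol (grid_index a l k @^-1` [set m']))).
    by rewrite ler_pM2l// exprn_gt0.
  rewrite /vol !lebn_grid_cell//= -exprMn.
  have h0 := mesh_gt0 l0.
  rewrite ler_pXn2r ?nnegrE ?mulr_ge0 ?(ltW (h0 _)) ?(ltW l0)//.
  case: k ik h2 => // k ik _; rewrite -meshS /mesh.
  rewrite ler_pM2l// lef_pV2 ?posrE ?exprn_gt0// ler_weXn2l ?ler1n//.
rewrite E1 E2 in g1 g2.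
have [k12|k12|//] := ltngtP k1 k2; exfalso.
- exact: low k12 g1 g2.
- exact: low k12 g2 g1.
Qed.

Section means.
Variables (b : rspace R n -> R) (beta : R).
Hypotheses (hb : bmo_le b beta) (beta0 : 0 < beta).
Variables (a : rspace R n) (l : R).
Hypothesis l0 : 0 < l.

Let W j := grow a l (2 ^+ j * l).

Let cW j : is_cube (W j).
Proof. by apply: is_cube_grow => //; rewrite mulr_ge0 ?exprn_ge0// ltW. Qed.

Let vW j : vol (W j) = (l + 2 * (2 ^+ j * l)) ^+ n.
Proof. by rewrite vol_grow ?mulr_ge0 ?exprn_ge0// ltW. Qed.

Lemma rmean_grow_dist j :
  `|rmean b (W j) - rmean b (grow a l l)| <= j%:R * (2 ^+ n * beta).
Proof.
have -> : grow a l l = W 0 by rewrite /W expr0 mul1r.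
elim: j => [|j IHj]; first by rewrite subrr normr0 mul0r.
have e : `|rmean b (W j) - rmean b (W j.+1)| <= 2 ^+ n * beta.
  apply: (le_trans (rmean_dist_cubes hb (cW j) (cW j.+1) _)).
    by apply: grow_sub_grow; rewrite ler_pM2r// ler_weXn2l// ler1n.
  rewrite ler_pdivrMr ?vol_gt0// [2 ^+ n * _]mulrC -mulrA ler_wpM2l ?(ltW beta0)//.
  rewrite !vW -exprMn ler_pXn2r ?nnegrE ?exprS//; last 2 first.
  - by rewrite !(addr_ge0, mulr_ge0, exprn_ge0)// ltW.
  - by rewrite !(addr_ge0, mulr_ge0, exprn_ge0)// ltW.
  by move: l0 (2 ^+ j) => l0' u; lra.
have := ler_distD (rmean b (W j)) (rmean b (W j.+1)) (rmean b (W 0)).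
rewrite [`|rmean b (W j.+1) - rmean b (W j)|]distrC.
by rewrite -natr1; move: e IHj; lra.
Qed.

(** Chain through the dilates of the reference cube: [P] fills a fixed proportion
    of the one with index [j.+1], and two consecutive dilates have volume ratio at
    most [2 ^ n]. The resulting linear growth in [j] is harmless against the factor
    [2 ^- j] that comes with large cubes. *)
Lemma rmean_gap_dist j P : is_cube P -> P `&` cube a l !=set0 ->
  gap (cube a l) j P ->
  `|rmean b P - rmean b (grow a l l)| <= (6 ^+ n + j.+1%:R * 2 ^+ n) * beta.
Proof.
move=> cP; have [a' [l' [l0' PE]]] := cP; move=> PQ /andP[g1 g2].
have p0 k : 0 <= 2 ^+ k * l by rewrite mulr_ge0 ?exprn_ge0// ltW.
have PW : P `<=` W j.+1.
  rewrite PE; apply: sub_grow; last by rewrite -PE.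
  rewrite -(ler_pXn2r n_gt0) ?nnegrE ?(ltW l0')//.
  rewrite -(@vol_cube _ _ a' l') ?(ltW l0')// -PE exprMn -exprM mulnC exprM.
  by rewrite -(@vol_cube _ _ a l) ?(ltW l0')// ltW// ltW.
have d1 : `|rmean b P - rmean b (W j.+1)| <= 6 ^+ n * beta.
  apply: (le_trans (rmean_dist_cubes hb cP (cW j.+1) PW)).
  rewrite ler_pdivrMr ?vol_gt0// [6 ^+ n * _]mulrC -mulrA ler_wpM2l ?(ltW beta0)//.
  apply: (@le_trans _ _ (6 ^+ n * ((2 ^+ n) ^+ j * vol (cube a l)))); last first.
    by rewrite ler_wpM2l// exprn_ge0.
  rewrite vW vol_cube ?(ltW l0)// -exprM mulnC exprM -!exprMn ler_pXn2r ?nnegrE//.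
  - have : 1 <= (2 : R) ^+ j by rewrite exprn_ege1// ler1n.
    rewrite exprS; move: (2 ^+ j) => u u1.
    have := ler_wpM2r (ltW l0) u1; move: (l0); lra.
  - by rewrite addr_ge0 ?mulr_ge0// ltW.
  - by rewrite mulr_ge0.
have := ler_distD (rmean b (W j.+1)) (rmean b P) (rmean b (grow a l l)).
move/le_trans; apply; rewrite mulrDl -mulrA; apply: lerD => //.
exact: rmean_grow_dist.
Qed.

End means.
End large_cubes.

(** * Summing over a sparse family at a point *)

Section pointwise_sums.
Context {R : realType} {n : nat}.
Hypothesis n_gt0 : (0 < n)%N.
Notation mu := (lebn R n).

Lemma sum_distinct_powers (t : seq nat) (q : R) : uniq t -> 0 <= q -> q < 1 ->
  \sum_(i <- t) q ^+ i <= (1 - q)^-1.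
Proof.
move=> ut q0 q1; have q10 : 0 < 1 - q by rewrite subr_gt0.
pose N := (\max_(i <- t) i).+1.
have tE : perm_eq t [seq i <- iota 0 N | i \in t].
  apply: uniq_perm => //; first by rewrite filter_uniq// iota_uniq.
  move=> i; rewrite mem_filter mem_iota /= add0n.
  by case: (boolP (i \in t)) => // it; rewrite ltnS; apply/esym/leq_bigmax_seq.
rewrite (perm_big _ tE) big_filter.
apply: (@le_trans _ _ (\sum_(i <- iota 0 N) q ^+ i)).
  rewrite [leRHS](bigID (mem t)) /= lerDl; apply: sumr_ge0 => i _.
  exact: exprn_ge0.
rewrite (_ : iota 0 N = index_iota 0 N); last by rewrite /index_iota subn0.
rewrite big_mkord.
rewrite -(ler_pM2r q10) mulVf ?gt_eqF// mulrC -opprB mulNr -subrX1 opprB.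
by rewrite gerBl exprn_ge0.
Qed.

Variables (D S : set (set (rspace R n))) (Q : set (rspace R n)).
Hypotheses (hD : dyadic_lattice D) (SD : S `<=` D).
Hypothesis cQ : is_cube Q.

Let Scube : S `<=` is_cube.
Proof. by move=> P /SD; case: hD => Dc _ _ _ /Dc. Qed.

(** The terms of the small cubes are counted by [overlap]; those of the large cubes
    form a subfamily of a geometric progression, because distinct cubes containing
    [x] have distinct scales. *)
Lemma esum_sparse (x : rspace R n) (h : set (rspace R n) -> \bar R)
    (A G q y : R) (M : \bar R) :
  Q x -> 0 <= A -> 0 <= G -> 0 <= q < 1 -> (0 <= M)%E ->
  (forall P, S P -> ~ P x -> h P = 0%E) ->
  (forall P, S P -> P x -> (vol P < vol Q)%R -> h P <= A%:E * M)%E ->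
  (forall P j, S P -> P x -> gap Q j P -> h P <= (G * q ^+ j)%:E * M)%E ->
  (forall s, uniq s -> (forall P, P \in s -> small_cubes S Q P) ->
    overlap s x <= y) ->
  (\esum_(P in S) h P <= (A * y + G / (1 - q))%:E * M)%E.
Proof.
move=> Qx A0 G0 /andP[q0 q1] M0 hN hsmall hlarge hy.
have g0 j : 0 <= G * q ^+ j by rewrite mulr_ge0// exprn_ge0.
have [scale scaleP] : exists j : set (rspace R n) -> nat,
    forall P, is_cube P -> vol Q <= vol P -> gap Q (j P) P.
  have /choice[j hj] : forall P, exists j, is_cube P -> vol Q <= vol P -> gap Q j P.
    move=> P; have [cP|] := pselect (is_cube P); last by exists 0%N.
    have [QP|] := leP (vol Q) (vol P); last by exists 0%N.
    by have [j] := exists_gap n_gt0 cP cQ QP; exists j.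
  by exists j.
apply: ge_ereal_sup => _ [X [finX XS] <-]; rewrite fsbig_finite//=.
set s : seq (set (rspace R n)) := finmap.enum_fset (fset_set X).
have us : uniq s by exact: finmap.fset_uniq.
have sS P : P \in s -> S P by rewrite in_fset_set// => /set_mem/XS.
pose u P : R := if `[< P x >] then (if vol P < vol Q then A else G * q ^+ scale P)
  else 0.
have u0 P : 0 <= u P by rewrite /u; case: ifP => // _; case: ifP.
apply: (@le_trans _ _ (\sum_(P <- s) ((u P)%:E * M))%E).
  rewrite big_seq [leRHS]big_seq; apply: lee_sum => P /sS SP.
  rewrite /u; case: asboolP => Px; last by rewrite hN// mul0e.
  have [PQ|QP] := ltP; first exact: hsmall.
  by apply: hlarge => //; apply: scaleP => //; exact: Scube.
rewrite -ge0_sume_distrl//; last by move=> P _; rewrite lee_fin.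
rewrite sumEFin; apply: lee_wpmul2r => //; rewrite lee_fin.
rewrite (bigID (fun P => `[< P x >])) /= [X in _ + X]big1 ?addr0; last first.
  by move=> P /negbTE; rewrite /u => ->.
rewrite (bigID (fun P => vol P < vol Q)) /=; apply: lerD.
  pose s1 := [seq P <- s | `[< P x >] && (vol P < vol Q)].
  have -> : \sum_(P <- s | `[< P x >] && (vol P < vol Q)) u P = A * overlap s1 x.
    rewrite /overlap mulr_sumr big_filter; apply: eq_bigr => P /andP[Px PQ].
    by rewrite /u Px PQ indicE mem_set ?mulr1//; exact/asboolP.
  apply: ler_wpM2l => //; apply: hy; first exact: filter_uniq.
  move=> P; rewrite mem_filter => /andP[/andP[/asboolP Px PQ] Ps]; split=> //.
    exact: sS.
  by apply/asboolP; exists x.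
pose s2 := [seq P <- s | `[< P x >] && ~~ (vol P < vol Q)].
have -> : \sum_(P <- s | `[< P x >] && ~~ (vol P < vol Q)) u P =
    G * \sum_(i <- map scale s2) q ^+ i.
  rewrite big_map mulr_sumr big_filter; apply: eq_bigr => P /andP[Px PQ].
  by rewrite /u Px (negbTE PQ).
apply: ler_wpM2l => //; apply: sum_distinct_powers => //.
rewrite map_inj_in_uniq; first exact: filter_uniq.
move=> P1 P2; rewrite !mem_filter -!leNgt.
move=> /andP[/andP[/asboolP P1x QP1] /sS SP1] /andP[/andP[/asboolP P2x QP2] /sS SP2] e.
apply: (dyadic_gap_inj n_gt0 (Q := Q) (j := scale P1) (x := x) hD) => //.
- exact: SD.
- exact: SD.
- by apply: scaleP => //; exact: Scube.
- by rewrite e; apply: scaleP => //; exact: Scube.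
Qed.

Variable f : rspace R n -> R.
Hypothesis fQ : [set x | f x != 0] `<=` Q.

Let F (x : rspace R n) : \bar R := `|f x|%:E.

Lemma integral_supp P (g : rspace R n -> \bar R) : measurable P ->
  (forall x, 0 <= g x)%E ->
  (\int[mu]_(x in P) (g x * F x) <= \int[mu]_(x in Q) (g x * F x))%E.
Proof.
move=> mP g0.
have -> : (\int[mu]_(x in P) (g x * F x) = \int[mu]_(x in P `&` Q) (g x * F x))%E.
  rewrite [RHS]integral_mkcondr; apply: eq_integral => x _; rewrite patchE.
  case: ifP => // /negbT xQ; rewrite /F (_ : f x = 0) ?normr0 ?mule0//.
  by apply/eqP/negPn/negP => fx; move/negP : xQ; apply; exact/mem_set/fQ.
have gF x : (0 <= g x * F x)%E by rewrite mule_ge0// lee_fin.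
by apply: ge0_integral_mono => // x [].
Qed.

Lemma gap_vol j P : is_cube P -> gap Q j P -> vol Q / vol P <= 2^-1 ^+ j.
Proof.
move=> cP /andP[g1 _]; rewrite ler_pdivrMr ?vol_gt0// exprVn ler_pdivlMl ?exprn_gt0//.
apply: le_trans g1; rewrite ler_pM2r ?vol_gt0// -exprM mulnC exprM.
by rewrite ler_eXnr// exprn_ege1// ler1n.
Qed.

(** The mass of [f] in [P] is at most its mass in [Q], while [vol P] is at least
    [2 ^ j * vol Q]. *)
Lemma avg_gap j P x : is_cube P -> Q x -> gap Q j P ->
  (avg P F <= (2^-1 ^+ j)%:E * maximal (EFin \o f) x)%E.
Proof.
move=> cP Qx gP; have mP := measurable_is_cube cP.
rewrite avg_le//; apply: (@le_trans _ _ (\int[mu]_(y in Q) F y)%E).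
  have one D' : (\int[mu]_(y in D') (cst 1 y * F y) = \int[mu]_(y in D') F y)%E.
    by apply: eq_integral => y _; rewrite mul1e.
  by rewrite -!one; exact: integral_supp.
rewrite integral_avgE//.
apply: (@le_trans _ _ ((vol Q)%:E * maximal (EFin \o f) x)%E).
  rewrite lee_pmul2l ?lte_fin ?vol_gt0//.
  exact: (@le_avg_maximal _ _ _ (EFin \o f)).
rewrite muleA -EFinM; apply: lee_wpmul2r; first exact: maximal_ge0.
by rewrite lee_fin -ler_pdivrMl ?vol_gt0// mulrC; exact: gap_vol.
Qed.

End pointwise_sums.

(** * Distribution of the sparse operator *)

Section decay.
Context {R : realType} {n : nat}.
Hypothesis n_gt0 : (0 < n)%N.
Notation mu := (lebn R n).
Variables (eta : R) (D S : set (set (rspace R n))) (Q : set (rspace R n)).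
Hypotheses (eta0 : 0 < eta) (hD : dyadic_lattice D) (SD : S `<=` D).
Hypotheses (Ssp : sparse eta S) (cQ : is_cube Q).
Variable f : rspace R n -> R.
Hypothesis fQ : [set x | f x != 0] `<=` Q.

Notation L := (@growth_rate R n eta).

Let Scube : S `<=` is_cube.
Proof. by move=> P /SD; case: hD => Dc _ _ _ /Dc. Qed.

Let F (x : rspace R n) : \bar R := `|f x|%:E.

(** The sum of the powers [2 ^ (- j * r0)], which bounds the contribution of the
    large cubes for every exponent [r >= r0]. *)
Definition large_const (r0 : R) : R := (1 - 2^-1 `^ r0)^-1.

Let half_pow r0 : 0 < r0 -> 0 <= (2^-1 : R) `^ r0 < 1.
Proof.
move=> r00; have e : (1 : R) `^ r0 = 1 by rewrite powR1.
rewrite powR_ge0/= -[ltRHS]e gt0_ltr_powR ?nnegrE//.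
by rewrite invf_lt1// ltr1n.
Qed.

(** Where the number of small cubes is at most [t ^ r - large_const r0], the sum of
    the [r]-th powers is at most [(t * Mf x) ^ r]. *)
Lemma sparse_A_decay r0 r t : 0 < r0 -> r0 <= r -> 0 < t ->
  (mu (Q `&` [set x | t%:E * maximal (EFin \o f) x <
                      sparse_A r S (fun y => `|f y|%R) x]) <=
   (2 * expR (L * large_const r0) * expR (- (L * t `^ r)))%:E * mu Q)%E.
Proof.
move=> r00 r0r t0; have r_gt0 := lt_le_trans r00 r0r.
have q01 := half_pow r00; have [q0 q1] := andP q01.
set C := large_const r0; pose y := t `^ r - C.
have [B [mB hB By]] := overlap_decay n_gt0 eta0 Scube Ssp cQ y.
apply: (@le_trans _ _ (mu B)); last first.
  apply: (le_trans hB); rewrite le_eqVlt; apply/orP; left; apply/eqP.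
  by congr (_%:E * _)%E; rewrite -mulrA -expRD; congr (_ * expR _); rewrite /y; ring.
apply: lebn_mono => x [Qx /= tx]; apply: contrapT => nBx.
have hy s : uniq s -> (forall P, P \in s -> small_cubes S Q P) -> overlap s x <= y.
  by move=> us hs; rewrite leNgt; apply/negP => ys; apply: nBx; exact: By ys.
have y0 : 0 <= y.
  by have := hy [::] isT; rewrite /overlap big_nil; apply.
move: tx; apply/negP; rewrite -leNgt.
set M := maximal _ x; have M0 : (0 <= M)%E by exact: maximal_ge0.
have [->|Moo] := eqVneq M +oo%E; first by rewrite mulry gtr0_sg// mul1e leey.
have Mfin : M \is a fin_num by rewrite ge0_fin_numE// ltey.
have m0 : 0 <= fine M by rewrite fine_ge0.
rewrite /sparse_A (_ : (fun y => _) = F); last first.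
  by apply/funext => z; rewrite normr_id.
have avg0 P : (0 <= avg P F)%E by apply: avg_ge0 => z _; rewrite lee_fin.
have powM P (k : R) : 0 <= k -> (avg P F <= k%:E * M)%E ->
    ((avg P F) `^ r <= (k `^ r)%:E * (fine M `^ r)%:E)%E.
  move=> k0 hk; rewrite -EFinM -powRM// -poweR_EFin EFinM fineK//.
  apply: (gt0_ler_poweR (ltW r_gt0)) => //; rewrite in_itv/= leey andbT//.
  by rewrite mule_ge0.
have sumE : (\esum_(P in S) (avg P F `^ r * (\1_P x)%:E) <=
    (1 * y + 1 / (1 - 2^-1 `^ r0))%:E * (fine M `^ r)%:E)%E.
  apply: (esum_sparse n_gt0 hD SD cQ Qx) => //.
  - by rewrite lee_fin powR_ge0.
  - by move=> P _ Px; rewrite indicE memNset// mule0.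
  - move=> P SP Px _; rewrite indicE mem_set// mule1 (_ : 1 = 1 `^ r); last by rewrite powR1.
    apply: powM => //; rewrite mul1e.
    by apply: (@le_avg_maximal _ _ _ (EFin \o f)) => //; exact: Scube.
  - move=> P j SP Px gP; rewrite indicE mem_set// mule1 mul1r.
    apply: (@le_trans _ _ (((2^-1 ^+ j) `^ r)%:E * (fine M `^ r)%:E)%E).
      apply: powM; first by rewrite exprn_ge0// invr_ge0.
      exact: (avg_gap n_gt0 cQ fQ (Scube SP) Qx gP).
    apply: lee_wpmul2r; first by rewrite lee_fin powR_ge0.
    rewrite lee_fin -!powR_mulrn ?powR_ge0 ?invr_ge0// powRAC.
    apply: ge0_ler_powR; rewrite ?nnegrE ?powR_ge0//.
    by apply: ger_powR => //; rewrite invr_gt0 ltr0n/= invf_le1// ler1n.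
rewrite (_ : 1 * y + _ = t `^ r) in sumE; last first.
  by rewrite /y /C /large_const; ring.
rewrite -EFinM -powRM ?(ltW t0)// in sumE.
have s0 : (0 <= \esum_(P in S) (avg P F `^ r * (\1_P x)%:E))%E.
  by apply: esum_ge0 => P _; rewrite mule_ge0 ?poweR_ge0// lee_fin.
rewrite [leRHS](_ : _ = (((t * fine M) `^ r)%:E `^ r^-1)%E); last first.
  rewrite poweR_EFin -powRrM mulfV ?gt_eqF// powRr1 ?mulr_ge0 ?(ltW t0)//.
  by rewrite EFinM fineK.
apply: gt0_ler_poweR => //.
- by rewrite invr_ge0 ltW.
- by rewrite in_itv/= leey s0.
- by rewrite in_itv/= leey lee_fin powR_ge0.
Qed.

End decay.

(** * Distribution of the commutator operators *)

Section commutator.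
Context {R : realType} {n : nat}.
Hypothesis n_gt0 : (0 < n)%N.
Notation mu := (lebn R n).
Notation C0 := (@stop_const R n).
Variables (eta : R) (D S : set (set (rspace R n))).
Hypotheses (eta0 : 0 < eta) (hD : dyadic_lattice D) (SD : S `<=` D).
Hypothesis Ssp : sparse eta S.
Variables (a : rspace R n) (l : R).
Hypothesis l0 : 0 < l.
Let Q := cube a l.
Let W := grow a l l.
Variable f : rspace R n -> R.
Hypotheses (mf : measurable_fun setT f) (fQ : [set x | f x != 0] `<=` Q).
Variables (b : rspace R n -> R) (beta : R).
Hypotheses (hb : bmo_le b beta) (beta0 : 0 < beta).

Let cQ : is_cube Q. Proof. by exists a, l. Qed.
Let cW : is_cube W. Proof. by apply: is_cube_grow => //; exact: ltW. Qed.
Let Scube : S `<=` is_cube.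
Proof. by move=> P /SD; case: hD => Dc _ _ _ /Dc. Qed.

Let vW : vol W = 3 ^+ n * vol Q.
Proof.
rewrite vol_grow ?vol_cube ?(ltW l0)// -exprMn; congr (_ ^+ _); lra.
Qed.

Let QW : Q `<=` W. Proof. by apply: sub_grow_self; exact: ltW. Qed.

Let small_sub P : small_cubes S Q P -> P `<=` W.
Proof.
move=> [/Scube[a' [l' [l0' ->]]] /asboolP mP vP].
by apply: sub_grow => //; rewrite -(le_vol_cube n_gt0 a' a)// ltW.
Qed.

Let c := rmean b W.
Let F (x : rspace R n) : \bar R := `|f x|%:E.

Let overlap_le_vol s : (forall P, P \in s -> is_cube P) ->
  (mu ([set x | (0 < overlap s x)%R] `&` Q) <= (\sum_(P <- s) vol P)%:E)%E.
Proof.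
elim: s => [_|P s IHs hs].
  rewrite big_nil (_ : _ `&` _ = set0) ?measure0//.
  by apply/seteqP; split=> // x [/=]; rewrite /overlap big_nil ltxx.
have cP : is_cube P by apply: hs; rewrite inE eqxx.
have hs' P' : P' \in s -> is_cube P' by move=> P's; apply: hs; rewrite inE P's orbT.
rewrite big_cons EFinD.
apply: (@le_trans _ _ (mu (P `|` ([set x | (0 < overlap s x)%R] `&` Q)))).
  apply: lebn_mono => x [/= x0 Qx]; have [Px|Px] := pselect (P x); first by left.
  by right; split=> //=; move: x0; rewrite /overlap big_cons indicE memNset// add0r.
have mo : measurable_fun setT (overlap s).
  apply: measurable_overlap; apply/allP => P' /hs'/measurable_is_cube ?.
  exact/asboolP.
apply: (le_trans (measureU2 _ _ _)); first exact: measurable_is_cube.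
  apply: measurableI; last exact: measurable_is_cube.
  rewrite (_ : mkset _ = overlap s @^-1` `]0, +oo[); last first.
    by apply/seteqP; split=> x /=; rewrite in_itv/= andbT.
  by rewrite -[X in measurable X]setTI; exact: mo.
by apply: leeD; [rewrite [leLHS]lebn_is_cube|exact: IHs].
Qed.

(** If the mean over [P] is far from [c], then [b] is far from [c] on a fixed
    proportion of the disjoint set attached to [P] by sparseness. *)
Let sum_far_means y s : uniq s ->
  (forall P, P \in s -> small_cubes S Q P /\ y * beta < `|rmean b P - c|) ->
  ((eta / 2 * \sum_(P <- s) vol P)%:E <=
   (2 * expR (- (ln 2 / C0 * (y - 2 / eta))))%:E * mu W)%E.
Proof.
move=> us hs; have [E [hE tE]] := Ssp.
pose E' P := E P `\` [set x | 2 / eta * beta < `|b x - rmean b P|].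
pose G := [set x | (y - 2 / eta) * beta < `|b x - c|].
have mG : measurable (G `&` W).
  by apply: measurableI; [exact: measurable_dist_gt hb _ _|exact: measurable_is_cube].
have mE' P : P \in s -> measurable (E' P).
  move=> /hs[[/hE[mE _ _] _ _] _]; apply: measurableD => //.
  exact: measurable_dist_gt hb _ _.
apply: (@le_trans _ _ (mu (G `&` W))); last exact: john_nirenberg.
apply: (sum_disjoint_le (E := E')) => //.
- move=> P1 P2 /hs[[S1 _ _] _] /hs[[S2 _ _] _] [x [[x1 _] [x2 _]]].
  by apply: tE => //; exists x.
- move=> P Ps; split; first exact: mE'.
  have [sP far] := hs _ Ps; have [SP _ _] := sP; have [_ EP _] := hE _ SP.
  move=> x [Ex /negP]; rewrite -leNgt => near; split; last exact/(small_sub sP)/EP.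
  rewrite /G/= mulrBl ltrBlDr (lt_le_trans far)//.
  rewrite (le_trans (ler_distD (b x) _ _))// addrC lerD2l distrC//.
- move=> P Ps; have [[SP _ _] _] := hs _ Ps; have [mE EP vE] := hE _ SP.
  have cP := Scube SP; have mP := measurable_is_cube cP.
  have mN := measurable_dist_gt hb (rmean b P) (2 / eta * beta).
  have far : (mu ([set x | 2 / eta * beta < `|b x - rmean b P|]%R `&` P) <=
      (eta / 2 * vol P)%:E)%E.
    have k0 : 0 < 2 / eta * beta by rewrite mulr_gt0// divr_gt0.
    rewrite -(@lee_pmul2l _ (2 / eta * beta)%:E) ?lte_fin//.
    apply: (@le_trans _ _ (\int[mu]_(x in P) `|b x - rmean b P|%:E)%E).
      apply: markov_set => //; first exact: ltW.
      by move=> x /= /ltW; rewrite lee_fin.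
    apply: (le_trans (integral_dist_rmean hb cP)); rewrite -EFinM lee_fin.
    rewrite le_eqVlt; apply/orP; left; apply/eqP; field.
    by rewrite gt_eqF.
  have vE' : (mu (E P) <= mu (E' P) + (eta / 2 * vol P)%:E)%E.
    apply: (@le_trans _ _ (mu (E' P `|`
        ([set x | 2 / eta * beta < `|b x - rmean b P|]%R `&` P)))).
      apply: lebn_mono => x Ex; have [far'|near'] := 
        pselect (2 / eta * beta < `|b x - rmean b P|); last by left.
      by right; split=> //; exact: EP.
    apply: (le_trans (measureU2 _ (mE' _ Ps) _)); first exact: measurableI.
    exact: leeD.
  have fE' : mu (E' P) \is a fin_num.
    rewrite ge0_fin_numE//; apply: (@le_lt_trans _ _ (mu P)).
      by apply: lebn_mono => x [/EP].
    by rewrite [ltLHS]lebn_is_cube// ltry.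
  move: (le_trans vE vE'); rewrite [mu P]lebn_is_cube// -(fineK fE') -EFinM -EFinD.
  by rewrite !lee_fin; move: (fine _) => z; lra.
Qed.

(** Small cubes with a mean far from [c] have a small total volume by
    [sum_far_means] and the John-Nirenberg inequality on [W]. *)
Lemma mean_decay y : exists B, [/\ measurable B,
  (mu B <= (4 / eta * 3 ^+ n * expR (ln 2 / C0 * (2 / eta)) *
            expR (- (ln 2 / C0 * y)))%:E * mu Q)%E &
  forall x P, Q x -> P x -> small_cubes S Q P ->
    y * beta < `|rmean b P - c| -> B x].
Proof.
pose A := small_cubes S Q `&` [set P | y * beta < `|rmean b P - c|].
have [||s us hs|B [mB hB AB]] := @overlap_limit _ _ _ cQ A 0
    ((4 / eta * 3 ^+ n * expR (ln 2 / C0 * (2 / eta)) *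
            expR (- (ln 2 / C0 * y)))%:E * mu Q)%E.
- apply: sub_countable (countable_small_cubes n_gt0 eta0 Scube Ssp cQ).
  by apply: subset_card_le => P [].
- by move=> P [[/Scube]].
- apply: le_trans (overlap_le_vol _) _ => [P /hs[[/Scube]]//|].
  have := sum_far_means us hs; rewrite [mu W]lebn_is_cube// [mu Q]lebn_is_cube//.
  rewrite -!EFinM !lee_fin vW => h.
  have e20 : 0 < eta / 2 by rewrite divr_gt0.
  rewrite -(ler_pM2l e20); apply: (le_trans h); rewrite le_eqVlt; apply/orP; left.
  rewrite mulrBr opprB expRD; apply/eqP; field.
  by rewrite gt_eqF.
exists B; split=> // x P Qx Px sP far; apply: (AB x [:: P]) => //.
- by move=> P'; rewrite inE => /eqP ->.
- by rewrite /overlap big_seq1 indicE mem_set.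
Qed.

Let M2 x := maximal (maximal (EFin \o f)) x.

Let M20 x : (0 <= M2 x)%E. Proof. exact: maximal_ge0. Qed.

Let F0 x : (0 <= F x)%E. Proof. by rewrite lee_fin. Qed.

Let le_maximal_maximal2 x : (maximal (EFin \o f) x <= M2 x)%E.
Proof. by apply: ge_ereal_sup => _ [P [cP Px] <-]; exact: le_avg_maximal2. Qed.

Let mean_gap j P x : is_cube P -> Q x -> P x -> gap Q j P ->
  `|rmean b P - c| <= 6 ^+ n * beta * (j%:R + 2).
Proof.
move=> cP Qx Px gP.
have PQ : P `&` Q !=set0 by exists x.
apply: (le_trans (rmean_gap_dist n_gt0 hb beta0 l0 cP PQ gP)).
rewrite mulrAC ler_pM2r//.
have : (2 : R) ^+ n <= 6 ^+ n by rewrite ler_pXn2r ?nnegrE// ler_nat.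
have : 0 <= (j.+1%:R : R) by []; rewrite -natr1; move: (2 ^+ n) (6 ^+ n) => u v.
by move=> j0 uv; have := ler_wpM2l j0 uv; lra.
Qed.

(** Since [f] lives on [Q], the oscillation on the large cube [P] can be replaced by
    the oscillation on [W] and the difference of the two means. *)
Let avg_osc_gap j P x : is_cube P -> Q x -> P x -> gap Q j P ->
  (avg P (fun y => osc b P y * F y) <=
   (2^-1 ^+ j * (6 ^+ n * beta * (j%:R + 6)))%:E * M2 x)%E.
Proof.
move=> cP Qx Px gP; have mP := measurable_is_cube cP.
have mQ := measurable_is_cube cQ.
have osc0 P' y : (0 <= osc b P' y)%E by exact: abse_ge0.
set k := `|rmean b P - c|; have k0 : 0 <= k by exact: normr_ge0.
have kle : k <= 6 ^+ n * beta * (j%:R + 2) by exact: mean_gap cP Qx Px gP.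
rewrite avg_le//; apply: (le_trans (integral_supp fQ mP (osc0 P))).
have mF D' : measurable_fun D' F.
  by apply: measurable_funTS; apply/measurable_EFinP; exact: measurableT_comp.
have mosc D' : measurable_fun D' (fun y => osc b W y * F y)%E.
  apply: emeasurable_funM => //; apply: measurable_funTS.
  rewrite (_ : osc b W = fun y => `|b y - c|%:E); first exact: measurable_dist hb _.
  by apply/funext => y; rewrite (oscE hb).
have t1 P' y : (0 <= osc b P' y * F y)%E by rewrite mule_ge0.
have t2 y : (0 <= k%:E * F y)%E by rewrite mule_ge0// lee_fin /k normr_ge0.
have t3 y : (0 <= osc b W y * F y + k%:E * F y)%E by rewrite adde_ge0.
apply: (@le_trans _ _ (\int[mu]_(y in Q) (osc b W y * F y + k%:E * F y))%E).
  apply: ge0_integral_mono => // y _.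
  rewrite -ge0_muleDl//; apply: lee_wpmul2r => //.
  rewrite !(oscE hb)// -EFinD lee_fin /k [`|rmean b P - c|]distrC.
  exact: ler_distD.
rewrite ge0_integralD//; last exact: measurable_funeM.
rewrite ge0_integralZl_EFin//.
have i1 : (\int[mu]_(y in Q) (osc b W y * F y) <=
    (vol W * (2 * C0 * beta))%:E * M2 x)%E.
  apply: (@le_trans _ _ (\int[mu]_(y in W) (osc b W y * F y))%E).
    exact: ge0_integral_mono.
  rewrite integral_avgE// EFinM -muleA lee_pmul2l ?lte_fin ?vol_gt0//.
  by apply: weighted_oscillation => //; exact: QW.
have i2 : (\int[mu]_(y in Q) F y <= (vol Q)%:E * M2 x)%E.
  rewrite integral_avgE// lee_pmul2l ?lte_fin ?vol_gt0//.
  exact: (@le_avg_maximal2 _ _ _ (EFin \o f)).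
apply: (@le_trans _ _ ((vol W * (2 * C0 * beta))%:E * M2 x +
    k%:E * ((vol Q)%:E * M2 x))%E).
  by apply: leeD => //; apply: lee_wpmul2l => //; rewrite lee_fin.
have vQ := vol_gt0 cQ; have vP := vol_gt0 cP.
have C00 : 0 < C0 by rewrite exprn_gt0.
rewrite !muleA -!EFinM -ge0_muleDl ?lee_fin ?mulr_ge0 ?(ltW vQ) ?(ltW beta0) ?(ltW C00) ?(ltW (vol_gt0 cW))//.
apply: lee_wpmul2r => //; rewrite -EFinD lee_fin vW.
have := gap_vol n_gt0 cQ cP gP; rewrite ler_pdivrMr// => g.
have e6 : 3 ^+ n * (2 * C0 * beta) = 6 ^+ n * beta * 4.
  have -> : (6 : R) ^+ n = 3 ^+ n * 2 ^+ n by rewrite -exprMn; congr (_ ^+ _); lra.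
  by rewrite /stop_const exprS; ring.
apply: (@le_trans _ _ (vol Q * (6 ^+ n * beta * (j%:R + 6)))).
  rewrite [3 ^+ n * vol Q]mulrC -[vol Q * 3 ^+ n * _]mulrA e6.
  have := ler_wpM2l (ltW vQ) kle; lra.
rewrite [vol P * _]mulrCA [leRHS]mulrA ler_wpM2r//.
by rewrite !mulr_ge0 ?exprn_ge0 ?(ltW beta0)// addr_ge0.
Qed.

(** For the large cubes, the linear growth of the means in [j] is absorbed by
    passing from the ratio [1 / 2] to [3 / 4]. *)
Let sum_sparse_T x y : Q x -> 0 <= y ->
  (forall s, uniq s -> (forall P, P \in s -> small_cubes S Q P) ->
    overlap s x <= y) ->
  `|b x - c| <= y * beta ->
  (forall P, P x -> small_cubes S Q P -> `|rmean b P - c| <= y * beta) ->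
  (sparse_T S b f x + sparse_Tstar S b f x <=
   (beta * (2 * y ^+ 2 + (2 * C0 + 4) * y + 32 * 6 ^+ n))%:E * M2 x)%E.
Proof.
move=> Qx y0 hy bx hP.
have C00 : 0 < C0 by rewrite exprn_gt0.
have s60 : 0 < (6 : R) ^+ n by rewrite exprn_gt0.
have osc0 P' z : (0 <= osc b P' z)%E by exact: abse_ge0.
have avg0 P : (0 <= avg P F)%E by exact: avg_ge0.
have avgo0 P : (0 <= avg P (fun z => osc b P z * F z))%E.
  by apply: avg_ge0 => z _; rewrite mule_ge0.
have i0 P : (0 <= (\1_P x : R)%:E)%E by rewrite lee_fin.
rewrite /sparse_T /sparse_Tstar -esumD => [|P _|P _]; last 2 first.
- by apply: mule_ge0; [apply: mule_ge0; [exact: osc0|exact: avg0]|exact: i0].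
- by apply: mule_ge0; [exact: avgo0|exact: i0].
rewrite [X in X%:E](_ : _ = (2 * y * beta + 2 * C0 * beta) * y +
    (y * beta + 8 * (6 ^+ n * beta)) / (1 - 3 / 4)); last by field.
apply: (esum_sparse n_gt0 hD SD cQ Qx) => //.
- by rewrite addr_ge0 ?mulr_ge0// ltW.
- by rewrite addr_ge0 ?mulr_ge0 ?(ltW s60)// ltW.
- by apply/andP; split; lra.
- by move=> P _ Px; rewrite indicE memNset// !mule0 adde0.
- move=> P SP Px PQ; have cP := Scube SP.
  have sP : small_cubes S Q P by split=> //; apply/asboolP; exists x.
  rewrite indicE mem_set// !mule1 EFinD ge0_muleDl ?lee_fin ?mulr_ge0 ?(ltW beta0) ?(ltW C00)//.
  apply: leeD; last exact: weighted_oscillation.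
  apply: lee_pmul => //; last exact: (@le_avg_maximal2 _ _ _ (EFin \o f)).
  rewrite (oscE hb)// lee_fin; apply: (le_trans (ler_distD c _ _)).
  by have := hP P Px sP; rewrite [`|c - _|]distrC; lra.
- move=> P j SP Px gP; have cP := Scube SP.
  rewrite indicE mem_set// !mule1.
  have h0 : 0 <= (2^-1 : R) ^+ j by rewrite exprn_ge0.
  apply: (@le_trans _ _ ((2^-1 ^+ j * (y * beta + 6 ^+ n * beta * (j%:R + 2)))%:E * M2 x +
      (2^-1 ^+ j * (6 ^+ n * beta * (j%:R + 6)))%:E * M2 x)%E).
    apply: leeD; last exact: avg_osc_gap.
    rewrite mulrC EFinM -muleA; apply: lee_pmul => //.
      rewrite (oscE hb)// lee_fin; apply: (le_trans (ler_distD c _ _)).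
      by have := mean_gap cP Qx Px gP; rewrite [`|c - _|]distrC; lra.
    apply: (le_trans (avg_gap n_gt0 cQ fQ cP Qx gP)).
    by apply: lee_wpmul2l.
  have j0 : 0 <= (j%:R : R) by [].
  have sb : 0 < 6 ^+ n * beta by rewrite mulr_gt0.
  have yb : 0 <= y * beta by rewrite mulr_ge0// ltW.
  rewrite -ge0_muleDl ?lee_fin ?mulr_ge0 ?addr_ge0 ?mulr_ge0 ?(ltW sb) ?(ltW beta0)//.
  apply: lee_wpmul2r => //; rewrite -EFinD lee_fin -mulrDr.
  rewrite (_ : 3 / 4 = 2^-1 * (3 / 2)); last by field.
  rewrite exprMn mulrCA ler_wpM2l//.
  have bern : 1 + j%:R / 2 <= (3 / 2 : R) ^+ j.
    elim: j {gP h0 j0} => [|j IHj]; first by rewrite mul0r addr0 expr0.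
    rewrite exprS -natr1; have : 0 <= (j%:R : R) by [].
    by move: (_ ^+ j) IHj => z; lra.
  move: (6 ^+ n * beta) sb => v v0; move: (y * beta) yb => u u0.
  move: (_ ^+ j) bern => z zj.
  have g0 : 0 <= u + 8 * v by lra.
  have := ler_wpM2l g0 zj; have := mulr_ge0 u0 j0; have := mulr_ge0 (ltW v0) j0.
  lra.
Qed.

Notation L := (@growth_rate R n eta).

Definition decay_rate : R := Num.min L (ln 2 / C0).

Definition decay_const : R := 2 + 2 * 3 ^+ n +
  4 / eta * 3 ^+ n * expR (ln 2 / C0 * (2 / eta)) + expR decay_rate.

Lemma decay_rate_gt0 : 0 < decay_rate.
Proof.
by rewrite lt_min growth_rate_gt0// divr_gt0 ?exprn_gt0// ln_gt0// ltr1n.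
Qed.

(** [y] is chosen so that the factor of [sum_sparse_T], which is at most
    [64 * 6 ^ n * beta * y ^ 2] for [y >= 1], does not exceed [t]; for [y < 1] the
    last term of [decay_const] makes the bound trivial. *)
Lemma sparse_T_decay t : 0 < t ->
  (mu (Q `&` [set x | t%:E * M2 x < sparse_T S b f x + sparse_Tstar S b f x]) <=
   (decay_const *
    expR (- (decay_rate * Num.sqrt (t / (64 * 6 ^+ n * beta)))))%:E * mu Q)%E.
Proof.
move=> t0; set y := Num.sqrt _; set d := decay_rate.
have d0 : 0 < d by exact: decay_rate_gt0.
have C00 : 0 < C0 by rewrite exprn_gt0.
have s60 : 0 < (6 : R) ^+ n by rewrite exprn_gt0.
have e40 : 0 <= 4 / eta * 3 ^+ n * expR (ln 2 / C0 * (2 / eta)).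
  by rewrite !mulr_ge0 ?exprn_ge0 ?expR_ge0 ?invr_ge0 ?(ltW eta0).
have y0 : 0 <= y by exact: sqrtr_ge0.
have vQ := vol_gt0 cQ.
have [y1|y1] := ltP y 1.
  apply: (@le_trans _ _ (mu Q)); first by apply: lebn_mono => x [].
  rewrite [leLHS]lebn_is_cube// [mu Q]lebn_is_cube// -EFinM lee_fin.
  rewrite ler_peMl ?(ltW vQ)//.
  apply: (@le_trans _ _ (expR d * expR (- (d * y)))).
    rewrite -expRD -expR0 ler_expR subr_ge0 ler_piMr ?(ltW d0)// ltW//.
  rewrite ler_wpM2r ?expR_ge0// /decay_const lerDr !addr_ge0//.
have [B1 [mB1 hB1 B1y]] := overlap_decay n_gt0 eta0 Scube Ssp cQ y.
have [B3 [mB3 hB3 B3y]] := mean_decay y.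
pose B2 := [set x | y * beta < `|b x - c|] `&` W.
have mB2 : measurable B2.
  by apply: measurableI; [exact: measurable_dist_gt hb _ _|exact: measurable_is_cube].
have hB2 : (mu B2 <= (2 * expR (- (ln 2 / C0 * y)))%:E * mu W)%E.
  exact: john_nirenberg.
apply: (@le_trans _ _ (mu (B1 `|` B2 `|` B3))).
  apply: lebn_mono => x [Qx tx]; apply: contrapT => nB; move: tx.
  apply/negP; rewrite -leNgt.
  apply: (@le_trans _ _ ((beta * (2 * y ^+ 2 + (2 * C0 + 4) * y + 32 * 6 ^+ n))%:E * M2 x)%E).
    apply: sum_sparse_T => //.
    - move=> s us hs; rewrite leNgt; apply/negP => ys.
      by apply: nB; left; left; exact: B1y ys.
    - rewrite leNgt; apply/negP => ys; apply: nB; left; right.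
      by split=> //; exact: QW.
    - move=> P Px sP; rewrite leNgt; apply/negP => ys.
      by apply: nB; right; exact: B3y ys.
  apply: lee_wpmul2r => //; rewrite lee_fin.
  have y2 : y ^+ 2 = t / (64 * 6 ^+ n * beta).
    by rewrite sqr_sqrtr// divr_ge0 ?mulr_ge0 ?(ltW t0) ?(ltW beta0) ?(ltW s60).
  have -> : t = beta * (64 * 6 ^+ n * y ^+ 2).
    by rewrite y2; field; rewrite !gt_eqF.
  rewrite ler_pM2l// /stop_const [2 ^+ n.+1]exprS.
  have c1 : (2 : R) ^+ n <= 6 ^+ n by rewrite ler_pXn2r ?nnegrE// ler_nat.
  have c2 : 6 <= (6 : R) ^+ n by rewrite ler_eXnr// ler1n.
  have yy : y <= y ^+ 2 by rewrite ler_eXnr.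
  have yy1 : 1 <= y ^+ 2 by rewrite exprn_ege1.
  move: (2 ^+ n) (6 ^+ n) (y ^+ 2) c1 c2 s60 yy yy1 => u v w c1 c2 v0 yy yy1.
  have := ler_wpM2r y0 c1; have w0 : 0 <= w by lra.
  have v0' := ltW v0; have := ler_wpM2l v0' yy; have := ler_wpM2l v0' yy1.
  have := ler_wpM2r w0 c2; move: yy y0 w0; lra.
have fin K : (K%:E * mu Q = (K * vol Q)%:E)%E by rewrite [mu Q]lebn_is_cube// -EFinM.
apply: (le_trans (measureU2 _ _ mB3)); first exact: measurableU.
apply: (le_trans (leeD (measureU2 _ mB1 mB2) hB3)).
apply: (le_trans (leeD (leeD hB1 hB2) (lexx _))).
rewrite [mu W]lebn_is_cube// vW !fin -EFinM -!EFinD lee_fin.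
have dL : expR (- (L * y)) <= expR (- (d * y)).
  by rewrite ler_expR lerN2 ler_wpM2r// /d /decay_rate ge_min lexx.
have dC : expR (- (ln 2 / C0 * y)) <= expR (- (d * y)).
  by rewrite ler_expR lerN2 ler_wpM2r// /d /decay_rate ge_min lexx orbT.
rewrite /decay_const -/d [2 * _ * (_ * vol Q)]mulrA -!mulrDl ler_wpM2r ?(ltW vQ)//.
have t3 : 0 <= 2 * (3 : R) ^+ n by rewrite mulr_ge0// exprn_ge0.
have := ler_wpM2l t3 dC; have := ler_wpM2l e40 dC.
have : 0 <= expR d * expR (- (d * y)) by rewrite mulr_ge0 ?expR_ge0.
move: dL (4 / eta * _ * _) => e K; lra.
Qed.

End commutator.

Theorem lemma3 (R : realType) (n : nat) (eta : R) (n_gt0 : (0 < n)%N)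
    (eta_gt0 : 0 < eta) (eta_lt1 : eta < 1) :
  exists2 c2 : R, 0 < c2 & forall r0 : R, 0 < r0 ->
  exists2 c1 : R, 0 < c1 &
  forall (D S : set (set (rspace R n))) (b f : rspace R n -> R)
    (Q : set (rspace R n)),
  dyadic_lattice D -> S `<=` D -> sparse eta S -> bmo b -> is_cube Q ->
  measurable_fun setT f -> [set x | f x != 0] `<=` Q ->
  forall t : R, 0 < t ->
  (forall r : R, r0 <= r ->
    (lebn R n (Q `&` [set x |
       t%:E * maximal (EFin \o f) x < sparse_A r S (fun y => `|f y|%R) x])
     <= (c1 * expR (- (c2 * t `^ r)))%:E * lebn R n Q)%E) /\
  (lebn R n (Q `&` [set x |
     t%:E * maximal (maximal (EFin \o f)) x <
     sparse_T S b f x + sparse_Tstar S b f x])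
   <= c1%:E * expeR (- sqrte (c2%:E * (t%:E / bmo_norm b))) * lebn R n Q)%E.
Proof.
set L := @growth_rate R n eta; set d := @decay_rate R n eta.
have d0 : 0 < d by exact: decay_rate_gt0.
have s60 : 0 < (6 : R) ^+ n by rewrite exprn_gt0.
have s61 : 1 <= (6 : R) ^+ n by rewrite exprn_ege1// ler1n.
(* so that [d * sqrt (t / (64 * 6 ^ n * beta))] is [sqrt (c2 * (t / beta))] *)
pose c2 := d ^+ 2 / (64 * 6 ^+ n).
have c20 : 0 < c2 by rewrite divr_gt0 ?exprn_gt0 ?mulr_gt0.
have d1 : d <= 1.
  apply: (@le_trans _ _ (ln 2 / @stop_const R n)); first by rewrite ge_min lexx orbT.
  rewrite ler_pdivrMr ?exprn_gt0// mul1r.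
  have : ln (2 : R) <= 1.
    by rewrite (_ : 2 = 1 + 1)// le_ln1Dx// (lt_trans (ltrN10 R)).
  by have := stop_const_ge4 (R := R) n_gt0; lra.
have c2L : c2 <= L.
  apply: (@le_trans _ _ d); last by rewrite ge_min lexx.
  rewrite ler_pdivrMr ?mulr_gt0// expr2 ler_pM2l//.
  by apply: (le_trans d1); lra.
have K0 : 0 < @decay_const R n eta.
  rewrite ltr_wpDl ?expR_gt0// !addr_ge0 ?mulr_ge0 ?exprn_ge0 ?expR_ge0//.
  by rewrite invr_ge0 ltW.
exists c2 => // r0 r00.
exists (2 * expR (L * large_const r0) + @decay_const R n eta).
  by rewrite addr_gt0// mulr_gt0// expR_gt0.
set c1 := _ + _ => D S b f Q hD SD Ssp [mb ib bmob] cQ mf fQ t t0.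
have lec1 : 2 * expR (L * large_const r0) <= c1 by rewrite lerDl ltW.
have leK1 : @decay_const R n eta <= c1 by rewrite lerDr mulr_ge0// expR_ge0.
have c10 : 0 < c1 by exact: lt_le_trans leK1.
split=> [r r0r|].
  apply: (le_trans (sparse_A_decay n_gt0 eta_gt0 hD SD Ssp cQ fQ r00 r0r t0)).
  apply: lee_wpmul2r; first exact: measure_ge0.
  rewrite lee_fin ler_pM ?mulr_ge0 ?expR_ge0// ler_expR lerN2.
  by rewrite ler_wpM2r// powR_ge0.
set A := Q `&` _.
have bound beta : 0 < beta -> bmo_le b beta ->
    (lebn R n A <= (c1 * expR (- Num.sqrt (c2 * (t / beta))))%:E * lebn R n Q)%E.
  move=> beta0 hb; have [a [l [l0 QE]]] := cQ.
  move: fQ; rewrite /A QE => fQ'.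
  apply: (le_trans (sparse_T_decay n_gt0 eta_gt0 hD SD Ssp l0 mf fQ' hb beta0 t0)).
  apply: lee_wpmul2r; first exact: measure_ge0.
  rewrite lee_fin ler_pM ?expR_ge0 ?(ltW K0)// ler_expR lerN2.
  rewrite le_eqVlt; apply/orP; left; apply/eqP.
  rewrite -/d -[in RHS](ger0_norm (ltW d0)) -sqrtr_sqr -sqrtrM ?sqr_ge0//.
  by congr Num.sqrt; rewrite /c2; field; rewrite !gt_eqF.
have osc_le P : is_cube P -> (avg P (osc b P) <= bmo_norm b)%E.
  by move=> cP; apply: ereal_sup_ubound; exists P.
have B0 : (0 <= bmo_norm b)%E.
  by apply: le_trans (osc_le Q cQ); apply: avg_ge0 => x _; exact: abse_ge0.
have [beta nE] : exists beta, bmo_norm b = beta%:E.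
  by exists (fine (bmo_norm b)); rewrite fineK// ge0_fin_numE.
rewrite nE; move: B0 osc_le; rewrite nE lee_fin => B0 osc_le.
have [beta0|beta0] := ltP 0 beta.
  rewrite inver gt_eqF// -!EFinM /=.
  by apply: bound => //; split.
have b0 : beta = 0 by apply/eqP; rewrite eq_le beta0 B0.
have -> : (c2%:E * (t%:E / beta%:E) = +oo)%E.
  by rewrite b0 inver eqxx gt0_muley ?lte_fin// gt0_muley ?lte_fin.
rewrite /= mule0 mul0e; apply/lee_addgt0Pr => e e0; rewrite add0e.
have vQ := vol_gt0 cQ.
(* a bound [beta' > 0] so small that the estimate for it is below [e] *)
pose z := c1 * vol Q / e; have z0 : 0 < z by rewrite divr_gt0// mulr_gt0.
pose beta' := c2 * t / z ^+ 2.
have beta'0 : 0 < beta' by rewrite divr_gt0 ?exprn_gt0// mulr_gt0.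
have hb' : bmo_le b beta'.
  split=> // P cP; apply: (le_trans (osc_le P cP)).
  by rewrite lee_fin b0 ltW.
apply: (le_trans (bound _ beta'0 hb')); rewrite [lebn R n Q]lebn_is_cube//.
have -> : c2 * (t / beta') = z ^+ 2.
  by rewrite /beta'; field; rewrite !gt_eqF.
rewrite sqrtr_sqr gtr0_norm// -EFinM lee_fin expRN.
have : c1 * vol Q <= expR z * e.
  rewrite -ler_pdivrMr// -/z; have := expR_ge1Dx z; lra.
by rewrite mulrAC ler_pdivrMr ?expR_gt0// mulrC [e * _]mulrC.
Qed.
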